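(* Let $a,b,c,d$ be positive reals, and define $$p_a=\frac{a}{4\pi^2}\int_0^{2\pi}\!\!\int_0^{2\pi}\frac{(b+ae^{-i\theta})\,d\phi\,d\theta}{(a+be^{i\theta})^2e^{-i\theta}+(c+de^{i\phi})^2e^{-i\phi}}.$$ - If $a\ge b+c+d$, then $p_a=1$. - If one of $b,c,d$ is larger than the sum of the other three of $\{a,b,c,d\}$, then $p_a=0$. - Otherwise, let $Q$ be a cyclic quadrilateral with edge lengths $a,c,b,d$ in cyclic order. Then $p_a$ is $\frac1{2\pi}$ times the angle of the arc of the circumscribed circle cut off by the edge $a$ of $Q$. Equivalently, $$p_a=\frac1\pi\arcsin\left(\frac{a\sqrt{(a+b+c-d)(a+b-c+d)(a-b+c+d)(-a+b+c+d)}}{2\sqrt{(ab+cd)(ac+bd)(ad+bc)}}\right),$$ where the branch of the arcsine is the one given by the preceding geometric description.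
   Context: The integral is the limit of the probability that a fixed $a$-edge lies in a random perfect matching of the weighted toroidal square grid. The arc cut off by edge $a$ is the arc between the two endpoints of that edge not containing the other vertices of $Q$; its angle is the corresponding central angle in $(0,2\pi)$. *)

(* Defs.v *)
From HB Require Import structures.
From mathcomp Require Import all_boot all_order all_algebra.
From mathcomp Require Import complex.
From mathcomp Require Import all_classical all_reals all_analysis.

Set Implicit Arguments.
Unset Strict Implicit.
Unset Printing Implicit Defensive.

Import Order.TTheory GRing.Theory Num.Theory.
Import numFieldNormedType.Exports.

Local Open Scope classical_set_scope.
Local Open Scope ring_scope.
Local Open Scope complex_scope.

Definition expi (R : realType) (t : R) : R[i] := cos t +i* sin t.

(* Lebesgue integral of a complex-valued function over [0, 2 pi]. *)
Definition cint (R : realType) (f : R -> R[i]) : R[i] :=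
  (\int[@lebesgue_measure R]_(t in `[0, 2 * pi]) complex.Re (f t)) +i*
  (\int[@lebesgue_measure R]_(t in `[0, 2 * pi]) complex.Im (f t)).

(* The denominator of the integrand vanishes at finitely many points of the
   torus; there the quotient takes the value 0, which does not affect the
   integral. *)
Definition edge_integrand (R : realType) (a b c d theta phi : R) : R[i] :=
  (b%:C + a%:C * expi (- theta)) /
  ((a%:C + b%:C * expi theta) ^+ 2 * expi (- theta)
   + (c%:C + d%:C * expi phi) ^+ 2 * expi (- phi)).

Definition edge_prob (R : realType) (a b c d : R) : R[i] :=
  (a / (4 * pi ^+ 2))%:C *
  cint (fun theta => cint (fun phi => edge_integrand a b c d theta phi)).

Definition dist2 (R : realType) (P Q : R * R) : R :=
  Num.sqrt ((P.1 - Q.1) ^+ 2 + (P.2 - Q.2) ^+ 2).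

Definition circ (R : realType) (O : R * R) (r t : R) : R * R :=
  (O.1 + r * cos t, O.2 + r * sin t).

(* A, B, C, D are met in this order in one counterclockwise turn. *)
Definition ccw_on_circle (R : realType) (O : R * R) (r : R)
    (A B C D : R * R) : Prop :=
  exists tA tB tC tD : R,
    [/\ tA < tB, tB < tC, tC < tD & tD < tA + 2 * pi] /\
    [/\ A = circ O r tA, B = circ O r tB, C = circ O r tC & D = circ O r tD].

Definition cyclic_quad (R : realType) (O : R * R) (r : R)
    (A B C D : R * R) : Prop :=
  0 < r /\ (ccw_on_circle O r A B C D \/ ccw_on_circle O r D C B A).

Definition arc (R : realType) (O : R * R) (r s alpha : R) : set (R * R) :=
  [set circ O r t | t in `[s, s + alpha]].

(* alpha is the central angle of the arc with endpoints A and B that contains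
   neither C nor D. *)
Definition cut_off_arc_angle (R : realType) (O : R * R) (r : R)
    (A B C D : R * R) (alpha : R) : Prop :=
  0 < alpha < 2 * pi /\
  exists s : R,
    [/\ (A = circ O r s /\ B = circ O r (s + alpha)) \/
        (B = circ O r s /\ A = circ O r (s + alpha)),
        ~ arc O r s alpha C & ~ arc O r s alpha D].

(* Q = ABCD, with edges a = AB, c = BC, b = CD, d = DA, and alpha is the angle
   of the arc cut off by the edge a. *)
Definition quad_with_angle (R : realType) (a b c d : R) (O : R * R) (r : R)
    (A B C D : R * R) (alpha : R) : Prop :=
  [/\ cyclic_quad O r A B C D,
      [/\ dist2 A B = a, dist2 B C = c, dist2 C D = b & dist2 D A = d] &
      cut_off_arc_angle O r A B C D alpha].

Definition arcsin_arg (R : realType) (a b c d : R) : R :=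
  a * Num.sqrt ((a + b + c - d) * (a + b - c + d) *
                (a - b + c + d) * (- a + b + c + d)) /
  (2 * Num.sqrt ((a * b + c * d) * (a * c + b * d) * (a * d + b * c))).

(* The inverse sine of x nearest to half the central angle alpha: the principal
   value when alpha <= pi, its supplement when the arc exceeds a half-circle. *)
Definition arcsin_branch (R : realType) (alpha x : R) : R :=
  if alpha <= pi then asin x else pi - asin x.

(* Main.v *)
Require Import Defs.
From HB Require Import structures.
From mathcomp Require Import all_boot all_order all_algebra.
From mathcomp Require Import complex ring lra.
From mathcomp Require Import all_classical all_reals all_analysis.
From mathcomp Require Import measurable_realfun.
Import Order.TTheory GRing.Theory Num.Theory.
Import numFieldNormedType.Exports.

Set Implicit Arguments.
Unset Strict Implicit.
Unset Printing Implicit Defensive.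

Local Open Scope classical_set_scope.
Local Open Scope ring_scope.
Local Open Scope complex_scope.

(* Write z = e^{i theta}, w = e^{i phi} and P = a + b z. For fixed theta the
   denominator is d^2 (w - q1) (w - q2) / w with
   q1, q2 = - (P -/+ E)^2 / (4 d^2 z), where E^2 = P^2 + 4 c d z. The inner
   integral is 2 pi / E when exactly one of q1, q2 lies in the unit disk and 0
   otherwise, and the first case is an affine condition on cos theta: it holds
   on an arc |theta| < theta0. There a / E is the derivative of
   theta + i log (2 a^2 + (2 a b + 4 c d) z + 2 a E), so p_a is
   (theta0 - arg (2 a^2 + (2 a b + 4 c d) z0 + 2 a E0)) / pi. If the sides are
   h sin A, h sin B, h sin C, h sin D with A + B + C + D = pi and C >= D, then
   theta0 = pi - (C - D), E0 = - h (sin C e^{-i(A+C)} + sin D e^{-i(B+C)}) and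
   the argument is theta0 - A, whence p_a = A / pi. If c or d is at least the
   sum of the other sides, the arc is empty; if a or b is, then theta0 = pi and
   the argument is 0 or pi, respectively. *)

(** * Improper integrals *)

(** [Rintegral] has a value even for a non-integrable function, so each evaluation must travel with
    integrability. Moreover [a / E] can blow up at theta = pi, where E vanishes for instance if c =
    d and a = b + 2 c. Hence the fundamental theorem is needed with one-sided limits at the ends,
    and integrability comes from monotone convergence, which asks for a fixed sign: on (0, pi) the
    imaginary part of [a / E] is never positive and the real part changes sign at most once.

    The primitive is the classical one of 1 / (z sqrt (quadratic in z)), rewritten with dz = i z
    dtheta. A continuous argument is obtained by taking E in the upper half-plane for 0 < theta <
    pi: then 2 a^2 + (2 a b + 4 c d) z + 2 a E lies there too, and its argument is an arctangent.
    The lower half of the circle is the conjugate picture, so the logarithms of the modulus cancel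
    and are never evaluated.

    The angles A, B, C, D are the inscribed angles over the sides and h is the diameter of the
    circle; they turn the relations at the endpoint into polynomial identities in sines and
    cosines. *)

Definition has_int {R : realType} (a b : R) (f : R -> R) (v : R) : Prop :=
  (@lebesgue_measure R).-integrable `]a, b[ (EFin \o f) /\
  (\int[@lebesgue_measure R]_(x in `]a, b[) f x) = v.

Section HasInt.
Context {R : realType}.
Implicit Types (a b c m v w k la lb : R) (f g F : R -> R).
Notation mu := (@lebesgue_measure R).

Lemma has_int_eq a b f g v :
  {in `]a, b[, f =1 g} -> has_int a b f v -> has_int a b g v.
Proof.
move=> fg [fi <-]; split.
  apply: eq_integrable fi => // x; rewrite inE/= => xab.
  by congr EFin; exact: fg.
by apply: eq_Rintegral => x; rewrite inE/= => xab; rewrite fg.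
Qed.

Lemma has_int_cat a b c f v w : a <= b -> b <= c ->
  has_int a b f v -> has_int b c f w -> has_int a c f (v + w).
Proof.
move=> ab bc [fi fv] [gi gw].
have [ab'|ab'] := eqVneq a b.
  rewrite -ab' in gi gw; split=> //.
  by rewrite gw -fv -ab' set_itvoo0 Rintegral_set0 add0r.
have [cb'|cb'] := eqVneq b c.
  rewrite -cb'; split=> //.
  by rewrite fv -gw -cb' set_itvoo0 Rintegral_set0 addr0.
have lab : a < b by rewrite lt_neqAle ab'.
have lbc : b < c by rewrite lt_neqAle cb'.
have iab : mu.-integrable `]a, b] (EFin \o f).
  apply/integrableP; move/integrableP : fi => [mf fi]; split.
    apply/measurable_EFinP/measurable_fun_itv_bndo_bndcP; exact/measurable_EFinP.
  by rewrite -integral_itv_bndo_bndc//; apply: measurableT_comp.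
have E : `]a, c[%classic = `]a, b] `|` `]b, c[.
  by rewrite -itv_bndbnd_setU// bnd_simp.
have mu1 : measurable (`]a, b] : set R) by [].
have fic : mu.-integrable `]a, c[ (EFin \o f).
  rewrite E.
  apply/integrableP; split.
    by apply/measurable_funU => //; split; [move/integrableP: iab => []|move/integrableP: gi => []].
  move/integrableP: (iab) => [m1 i1]; move/integrableP: (gi) => [m2 i2].
  have mU : measurable_fun (`]a, b] `|` `]b, c[) (EFin \o f) by apply/measurable_funU.
  rewrite ge0_integral_setU//.
  - exact: lte_add_pinfty.
  - by apply: measurableT_comp mU.
  - rewrite disj_set2E; apply/eqP; rewrite -subset0 => x [] /=; rewrite !in_itv/= => /andP[_ xb] /andP[bx _].
    by move: (lt_le_trans bx xb); rewrite ltxx.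
split=> //.
rewrite E Rintegral_setU//; last 2 first.
- by rewrite -E.
- rewrite disj_set2E; apply/eqP; rewrite -subset0 => x [] /=; rewrite !in_itv/= => /andP[_ xb] /andP[bx _].
  by move: (lt_le_trans bx xb); rewrite ltxx.
by rewrite -Rintegral_itv_bndo_bndc// fv gw.
Qed.

Lemma has_int_cc a b f v : has_int a b f v -> \int[mu]_(x in `[a, b]) f x = v.
Proof.
move=> [fi <-]; rewrite /Rintegral integral_itv_bndoo//.
by case/integrableP : fi.
Qed.

Lemma has_int_triv a f : has_int a a f 0.
Proof.
split; rewrite set_itv_ge ?bnd_simp ?ltxx//; last by rewrite Rintegral_set0.
exact: integrable_set0.
Qed.

Lemma has_intZ k a b f v : has_int a b f v -> has_int a b (fun x => k * f x) (k * v).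
Proof.
move=> [fi <-]; split; last by rewrite RintegralZl.
by apply: eq_integrable (integrableZl _ k fi).
Qed.

Lemma has_intD a b f g v w : has_int a b f v -> has_int a b g w ->
  has_int a b (fun x => f x + g x) (v + w).
Proof.
move=> [fi <-] [gi <-]; split; last by rewrite RintegralD.
by apply: eq_integrable (integrableD _ fi gi).
Qed.

Lemma has_int0 a b : has_int a b (fun=> 0) 0.
Proof.
split; last by rewrite /Rintegral integral0_eq.
exact: integrable0.
Qed.

Lemma has_int_ftc a b f F : a < b ->
  (forall x, x \in `[a, b] -> is_derive x 1 F (f x)) ->
  (forall x, x \in `[a, b] -> {for x, continuous f}) ->
  has_int a b f (F b - F a).
Proof.
move=> ab dF cf.
have wf : {within `[a, b], continuous f}.
  by apply: continuous_in_subspaceT => x; rewrite inE/=; exact: cf.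
have cF x : x \in `[a, b] -> {for x, continuous F}.
  by move=> /dF [dFx _]; apply: differentiable_continuous; exact/derivable1_diffP.
have fi : mu.-integrable `[a, b] (EFin \o f).
  by apply: continuous_compact_integrable => //; exact: segment_compact.
have fo : mu.-integrable `]a, b[ (EFin \o f).
  by apply: integrableS fi => //; exact: subset_itv_oo_cc.
split=> //.
rewrite /Rintegral -(@integral_itv_bndoo _ a b _ true false); last by case/integrableP : fo.
rewrite (continuous_FTC2 ab wf (F:=F)) //.
- split.
  + by move=> x xab; case: (dF x (subset_itv_oo_cc xab)).
  + by apply: cvg_at_right_filter; apply: cF; rewrite in_itv/= lexx ltW.
  + by apply: cvg_at_left_filter; apply: cF; rewrite in_itv/= lexx ltW.
- move=> x xab; rewrite derive1E.
  by case: (dF x (subset_itv_oo_cc xab)).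
Qed.

(** The sign condition replaces an integrability hypothesis: on compact subintervals exhausting []a,
    b[] the integrals are increments of [F], and monotone convergence yields at once the value and
    its finiteness. *)
Lemma has_int_ftc_ge0 a b f F la lb : a < b ->
  (forall x, x \in `]a, b[ -> is_derive x 1 F (f x)) ->
  (forall x, x \in `]a, b[ -> {for x, continuous f}) ->
  (forall x, x \in `]a, b[ -> 0 <= f x) ->
  F x @[x --> a^'+] --> la -> F x @[x --> b^'-] --> lb ->
  has_int a b f (lb - la).
Proof.
move=> ab dF cf f0 Fa Fb.
(* The denominator starts at 3, so that [a + e n < b - e n] for every [n]. *)
pose e (n : nat) := (b - a) / n.+3%:R.
have e0 n : 0 < e n by rewrite divr_gt0 ?subr_gt0.
have e2 n : e n < (b - a) / 2.
  by rewrite ltr_pM2l ?subr_gt0// ltf_pV2 ?posrE// ltr_nat.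
have ecvg : e n @[n --> \oo] --> 0.
  rewrite -[X in _ --> X](mulr0 (b - a)); apply: cvgM; first exact: cvg_cst.
  have := @cvg_harmonic R; rewrite -(cvg_shiftn 2).
  by under eq_fun do rewrite /= addn2.
pose I n := `[a + e n, b - e n]%classic : set R.
have Isub n : I n `<=` `]a, b[.
  move=> x; rewrite /I/= !in_itv/= => /andP[h1 h2]; have := e0 n; lra.
have cupI : \bigcup_n I n = `]a, b[%classic.
  apply/seteqP; split=> [x [n _] /Isub//|x /=]; rewrite in_itv/= => /andP[ax xb].
  have m0 : 0 < Num.min (x - a) (b - x) by rewrite lt_min !subr_gt0 ax.
  have [n _ /(_ n (leqnn n)) /= hn] : \forall n \near \oo, e n < Num.min (x - a) (b - x).
    exact: (cvgr_lt 0).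
  exists n => //; rewrite /I/= in_itv/=.
  by move: hn; rewrite lt_min => /andP[]; lra.
have mfo : measurable_fun `]a, b[ f.
  by apply: open_continuous_measurable_fun => // x; rewrite inE/=; exact: cf.
have intI n : (\int[mu]_(x in I n) (f x)%:E = (F (b - e n) - F (a + e n))%:E)%E.
  have lt : a + e n < b - e n by have := e2 n; lra.
  have mI : mu.-integrable (I n) (EFin \o f).
    apply: continuous_compact_integrable => //; first exact: segment_compact.
    by apply: continuous_in_subspaceT => x; rewrite inE/= => /Isub; exact: cf.
  have [fi <-] := has_int_ftc lt (fun x xI => dF x (Isub n x xI))
      (fun x xI => cf x (Isub n x xI)).
  rewrite /Rintegral fineK; last exact: integrable_fin_num.
  by rewrite /I integral_itv_bndoo//; case/integrableP: fi.
have mono : nondecreasing_seq I.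
  apply/nondecreasing_seqP => n; rewrite subsetEset => x; rewrite /I/= !in_itv/=.
  have : e n.+1 <= e n by rewrite ler_pM2l ?subr_gt0// lef_pV2 ?posrE// ler_nat.
  by move=> h /andP[]; lra.
have C1 : (\int[mu]_(x in I n) (f x)%:E @[n --> \oo] --> \int[mu]_(x in `]a, b[) (f x)%:E)%E.
  rewrite -cupI; apply: ge0_nondecreasing_set_cvg_integral => //.
  - by move=> n; apply: measurable_itv.
  - by move=> n; apply/measurable_EFinP; apply: measurable_funS mfo.
  - by move=> n x /Isub xab; rewrite lee_fin; exact: f0.
have C2 : (\int[mu]_(x in I n) (f x)%:E @[n --> \oo] --> (lb - la)%:E)%E.
  under eq_fun do rewrite intI.
  apply: cvg_EFin; first exact: nearW.
  apply: cvgB.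
  - have /cvg_at_leftP := Fb; apply; split=> [n|]; first by rewrite ltrBlDr ltrDl.
    by rewrite -[X in _ --> X](subr0 b); apply: cvgB => //; exact: cvg_cst.
  - have /cvg_at_rightP := Fa; apply; split=> [n|]; first by rewrite ltrDl.
    by rewrite -[X in _ --> X](addr0 a); apply: cvgD => //; exact: cvg_cst.
have E := cvg_unique (@ereal_hausdorff R) C1 C2.
split; last by rewrite /Rintegral E.
apply/integrableP; split; first exact/measurable_EFinP.
under eq_integral => x /[!inE] xab do rewrite gee0_abs ?lee_fin ?f0//.
by rewrite E ltry.
Qed.

Lemma has_int_ftc_le0 a b f F la lb : a < b ->
  (forall x, x \in `]a, b[ -> is_derive x 1 F (f x)) ->
  (forall x, x \in `]a, b[ -> {for x, continuous f}) ->
  (forall x, x \in `]a, b[ -> f x <= 0) ->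
  F x @[x --> a^'+] --> la -> F x @[x --> b^'-] --> lb ->
  has_int a b f (lb - la).
Proof.
move=> ab dF cf f0 Fa Fb.
have : has_int a b (fun x => - f x) (- lb - - la).
  apply: (has_int_ftc_ge0 (F := fun x => - F x)) => //.
  - by move=> x /dF h; apply: is_deriveN.
  - by move=> x /cf h; apply: cvgN.
  - by move=> x /f0; rewrite oppr_ge0.
  - exact: cvgN.
  - exact: cvgN.
move=> /(has_intZ (-1)).
rewrite (_ : -1 * _ = lb - la); last by ring.
by apply: has_int_eq => x _; rewrite mulN1r opprK.
Qed.

(** Suited to the real part of [a / E], whose only possible change of sign is from plus to minus. At
    an interior [m] the primitive is continuous, so its values there cancel; [m] may also be an
    end. *)
Lemma has_int_ftc_ge0_le0 a m b f F la lb : a <= m -> m <= b -> a < b ->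
  (forall x, x \in `]a, b[ -> is_derive x 1 F (f x)) ->
  (forall x, x \in `]a, b[ -> {for x, continuous f}) ->
  (forall x, x \in `]a, m[ -> 0 <= f x) ->
  (forall x, x \in `]m, b[ -> f x <= 0) ->
  F x @[x --> a^'+] --> la -> F x @[x --> b^'-] --> lb ->
  has_int a b f (lb - la).
Proof.
move=> am mb ab dF cf f0 f1 Fa Fb.
have [ame|ne] := eqVneq a m.
  by rewrite -ame in f1; exact: (has_int_ftc_le0 (F := F)).
have [mbe|ne'] := eqVneq m b.
  by rewrite mbe in f0; exact: (has_int_ftc_ge0 (F := F)).
have am' : a < m by rewrite lt_neqAle ne.
have mb' : m < b by rewrite lt_neqAle ne'.
have cF : {for m, continuous F}.
  have [|dFx _] := dF m; first by rewrite in_itv/= am'.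
  by apply: differentiable_continuous; exact/derivable1_diffP.
have dl x : x \in `]a, m[ -> x \in `]a, b[ by rewrite !in_itv/=; lra.
have dr x : x \in `]m, b[ -> x \in `]a, b[ by rewrite !in_itv/=; lra.
have cl : F x @[x --> m^'-] --> F m by exact: cvg_at_left_filter.
have cr : F x @[x --> m^'+] --> F m by exact: cvg_at_right_filter.
have i1 : has_int a m f (F m - la).
  exact: (has_int_ftc_ge0 am' (fun x h => dF x (dl x h)) (fun x h => cf x (dl x h))
    f0 Fa cl).
have i2 : has_int m b f (lb - F m).
  exact: (has_int_ftc_le0 mb' (fun x h => dF x (dr x h)) (fun x h => cf x (dr x h))
    f1 cr Fb).
have := has_int_cat am mb i1 i2.
by rewrite (_ : F m - la + (lb - F m) = lb - la); last by ring.
Qed.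

End HasInt.

(** * Poles inside and outside the unit circle *)

Section DeriveArg.
Context {R : realType}.
Implicit Types (f u v : R -> R) (t x du dv : R).

Lemma is_derive1_continuous f x df : is_derive x 1 f df -> {for x, continuous f}.
Proof. by case=> dfx _; apply: differentiable_continuous; exact/derivable1_diffP. Qed.

(** [atan (u / v)] is an argument of v + i u, and this is the imaginary part of its logarithmic
    derivative; [is_derive_ln_norm2] gives the real part. *)
Lemma is_derive_atan_div u v t du dv : v t != 0 ->
  is_derive t 1 u du -> is_derive t 1 v dv ->
  is_derive t 1 (fun s => atan (u s / v s))
    ((du * v t - u t * dv) / (u t ^+ 2 + v t ^+ 2)).
Proof.
move=> v0 hu hv.
have hV := is_deriveV v0 hv.
have hM := is_deriveM hu hV.
have h := @is_derive1_comp _ atan (fun s => u s / v s) t _ _ (is_derive1_atan (u t / v t)) hM.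
apply: (is_derive_eq h).
have h1 : 1 + (u t / v t) ^+ 2 != 0 by rewrite gt_eqF// ltr_pwDl// sqr_ge0.
have h2 : u t ^+ 2 + v t ^+ 2 != 0.
  by rewrite gt_eqF// ltr_wpDl ?sqr_ge0// exprn_even_gt0.
have -> : u t ^+ 2 + v t ^+ 2 = v t ^+ 2 * (1 + (u t / v t) ^+ 2) by field.
by rewrite /GRing.scale/=; field; rewrite ?v0 ?[_ + u t ^+ 2]addrC ?h2.
Qed.

Lemma is_derive_ln_norm2 u v t du dv : 0 < u t ^+ 2 + v t ^+ 2 ->
  is_derive t 1 u du -> is_derive t 1 v dv ->
  is_derive t 1 (fun s => ln (u s ^+ 2 + v s ^+ 2) / 2)
    ((u t * du + v t * dv) / (u t ^+ 2 + v t ^+ 2)).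
Proof.
move=> n0 hu hv.
have hQ : is_derive t 1 (fun s => u s ^+ 2 + v s ^+ 2) (2 * (u t * du + v t * dv)).
  by apply: is_derive_eq; rewrite /GRing.scale/=; ring.
have h := @is_derive1_comp _ (@ln R) (fun s => u s ^+ 2 + v s ^+ 2) t _ _ (is_derive1_ln n0) hQ.
have h' := is_deriveM h (is_derive_cst (2^-1 : R) t 1).
apply: (is_derive_eq h').
by rewrite /GRing.scale/=; field; rewrite gt_eqF.
Qed.

End DeriveArg.

(** * Complex-valued integrals over an interval *)

Definition nsq {R : realType} (x : R[i]) : R := complex.Re x ^+ 2 + complex.Im x ^+ 2.

Definition has_cint {R : realType} (a b : R) (f : R -> R[i]) (v : R[i]) : Prop :=
  has_int a b (fun t => complex.Re (f t)) (complex.Re v) /\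
  has_int a b (fun t => complex.Im (f t)) (complex.Im v).

Section HasCint.
Context {R : realType}.
Implicit Types (a b c : R) (f g : R -> R[i]) (v w k x y : R[i]).

Lemma ReD x y : complex.Re (x + y) = complex.Re x + complex.Re y.
Proof. by case: x y => [? ?] [? ?]. Qed.

Lemma ImD x y : complex.Im (x + y) = complex.Im x + complex.Im y.
Proof. by case: x y => [? ?] [? ?]. Qed.

Lemma ReM x y : complex.Re (x * y) =
  complex.Re x * complex.Re y - complex.Im x * complex.Im y.
Proof. by case: x y => [? ?] [? ?]. Qed.

Lemma ImM x y : complex.Im (x * y) =
  complex.Re x * complex.Im y + complex.Im x * complex.Re y.
Proof. by case: x y => [? ?] [? ?]. Qed.

Lemma has_cint_eq a b f g v :
  {in `]a, b[, f =1 g} -> has_cint a b f v -> has_cint a b g v.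
Proof.
move=> fg [h1 h2]; split.
  by apply: has_int_eq h1 => t /fg ->.
by apply: has_int_eq h2 => t /fg ->.
Qed.

Lemma has_cint_cat a b c f v w : a <= b -> b <= c ->
  has_cint a b f v -> has_cint b c f w -> has_cint a c f (v + w).
Proof.
move=> ab bc [h1 h2] [k1 k2]; split.
  by rewrite ReD; exact: has_int_cat h1 k1.
by rewrite ImD; exact: has_int_cat h2 k2.
Qed.

Lemma has_cint_cint f v : has_cint 0 (2 * pi) f v -> cint f = v.
Proof.
move=> [/has_int_cc h1 /has_int_cc h2]; rewrite /cint h1 h2.
by case: v {h1 h2}.
Qed.

Lemma has_cintZ k a b f v : has_cint a b f v -> has_cint a b (fun s => k * f s) (k * v).
Proof.
move=> [h1 h2]; split.
  rewrite ReM -mulNr.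
  apply: has_int_eq (has_intD (has_intZ (complex.Re k) h1) (has_intZ (- complex.Im k) h2)).
  by move=> t _; rewrite ReM mulNr.
rewrite ImM.
apply: has_int_eq (has_intD (has_intZ (complex.Re k) h2) (has_intZ (complex.Im k) h1)).
by move=> t _; rewrite ImM.
Qed.

Lemma has_cintD a b f g v w : has_cint a b f v -> has_cint a b g w ->
  has_cint a b (fun s => f s + g s) (v + w).
Proof.
move=> [h1 h2] [k1 k2]; split.
  rewrite ReD; apply: has_int_eq (has_intD h1 k1) => t _; by rewrite ReD.
rewrite ImD; apply: has_int_eq (has_intD h2 k2) => t _; by rewrite ImD.
Qed.

Lemma has_cint_conj a b f v : has_cint a b f v -> has_cint a b (fun s => (f s)^*) (v^*).
Proof.
move=> [h1 h2]; split.
  by case: v h1 h2 => p q /= h1 h2; apply: has_int_eq h1 => t _; case: (f t).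
have := has_intZ (-1) h2; rewrite mulN1r => h.
by case: v {h1 h2} h => p q /= h; apply: has_int_eq h => t _; case: (f t) => ? ?/=; rewrite mulN1r.
Qed.

Lemma has_cint_cst a b k : a < b -> has_cint a b (fun=> k) ((b - a)%:C * k).
Proof.
move=> ab; split; rewrite ?ReM ?ImM /= mul0r ?subr0 ?addr0.
  have := @has_int_ftc _ a b (fun=> complex.Re k) (fun t => t * complex.Re k) ab.
  rewrite -mulrBl; apply => t _; last exact: cvg_cst.
  by apply: is_derive_eq; rewrite /GRing.scale/=; ring.
have := @has_int_ftc _ a b (fun=> complex.Im k) (fun t => t * complex.Im k) ab.
rewrite -mulrBl; apply => t _; last exact: cvg_cst.
by apply: is_derive_eq; rewrite /GRing.scale/=; ring.
Qed.

Lemma has_cint0 a b : has_cint a b (fun=> 0) 0.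
Proof. by split; exact: has_int0. Qed.

Lemma nsqM x y : nsq (x * y) = nsq x * nsq y.
Proof. by case: x y => [p q] [r s]; rewrite /nsq/=; ring. Qed.

Lemma nsq_conj x : nsq x^* = nsq x.
Proof. by case: x => [p q]; rewrite /nsq/= sqrrN. Qed.

Lemma nsqN x : nsq (- x) = nsq x.
Proof. by case: x => [p q]; rewrite /nsq/= !sqrrN. Qed.

Lemma nsq_ge0 x : 0 <= nsq x.
Proof. by rewrite addr_ge0 ?sqr_ge0. Qed.

Lemma nsq_eq0 x : (nsq x == 0) = (x == 0).
Proof.
case: x => p q; rewrite /nsq/= paddr_eq0 ?sqr_ge0// !expf_eq0/=.
by rewrite eq_complex.
Qed.

Lemma nsq_gt0 x : (0 < nsq x) = (x != 0).
Proof. by rewrite lt_neqAle nsq_ge0 andbT eq_sym nsq_eq0. Qed.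

Lemma mul_conj_nsq x : x * x^* = (nsq x)%:C.
Proof. by case: x => p q; rewrite /nsq; apply/eqP; rewrite eq_complex/=; apply/andP; split; apply/eqP; ring. Qed.

Lemma nsqV x : nsq x^-1 = (nsq x)^-1.
Proof.
have [->|x0] := eqVneq x 0; first by rewrite invr0 /nsq/= expr0n/= addr0 invr0.
have h0 : nsq x != 0 by rewrite nsq_eq0.
apply: (mulIf h0); rewrite mulVf// -nsqM mulVf//.
by rewrite /nsq/= expr1n expr0n addr0.
Qed.

Lemma nsq_expi (t : R) : nsq (expi t) = 1.
Proof. exact: cos2Dsin2. Qed.

Lemma expi_neq0 (t : R) : expi t != 0.
Proof. by rewrite -nsq_eq0 nsq_expi oner_eq0. Qed.

Lemma expiN (t : R) : expi (- t) = (expi t)^*.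
Proof. by rewrite /expi cosN sinN. Qed.

Lemma conj_expi (t : R) : (expi t)^* = (expi t)^-1.
Proof.
apply: (mulfI (expi_neq0 t)); rewrite mul_conj_nsq nsq_expi divff//.
exact: expi_neq0.
Qed.

(* With g = 1 - q / w on the unit circle, q / (w - q) = 1 / g - 1 is the
   derivative of -i log g, and g stays in the right half-plane. *)
Lemma has_cint_pole_in q : nsq q < 1 ->
  has_cint 0 (2 * pi : R) (fun t : R => q / (expi t - q)) 0.
Proof.
case: q => p q; rewrite /nsq/= => q1.
(* Here u + i v = 1 - q / w. As [p * cos t + q * sin t] has absolute value at most the modulus of
   the pole, [u] stays positive, so [atan (v / u)] is a smooth periodic argument and both primitives
   return to their initial values. *)
pose u t : R := 1 - p * cos t - q * sin t.
pose v t : R := p * sin t - q * cos t.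
have q2 t : (p * cos t + q * sin t) ^+ 2 < 1.
  have := cos2Dsin2 t; have : 0 <= v t ^+ 2 by exact: sqr_ge0.
  rewrite /v; nra.
have u0 (t : R) : 0 < u t.
  have := q2 t; rewrite /u; nra.
have n0 (t : R) : 0 < u t ^+ 2 + v t ^+ 2.
  by rewrite ltr_pwDl ?sqr_ge0// exprn_gt0.
have du (t : R) : is_derive t 1 u (v t).
  by rewrite /u /v; apply: is_derive_eq; rewrite /GRing.scale/=; ring.
have dv (t : R) : is_derive t 1 v (1 - u t).
  by rewrite /u /v; apply: is_derive_eq; rewrite /GRing.scale/=; ring.
have E (t : R) : (p +i* q) / (expi t - (p +i* q)) =
    (u t / (u t ^+ 2 + v t ^+ 2) - 1) +i* (- v t / (u t ^+ 2 + v t ^+ 2)).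
  have w0 : expi t - (p +i* q) != 0.
    apply/eqP => /subr0_eq /(congr1 nsq); rewrite nsq_expi /nsq/= => h.
    by move: q1; rewrite -h ltxx.
  apply: (mulIf w0); rewrite divfK//.
  have h0 : u t ^+ 2 + v t ^+ 2 != 0 by rewrite gt_eqF.
  have cs : cos t ^+ 2 = 1 - sin t ^+ 2 by rewrite -(cos2Dsin2 t) addrK.
  apply/eqP; rewrite eq_complex/=; apply/andP; split; apply/eqP.
    have e : u t * (cos t - p) + v t * (sin t - q) = cos t * (u t ^+ 2 + v t ^+ 2).
      by rewrite /u /v; ring: cs.
    transitivity ((u t * (cos t - p) + v t * (sin t - q)) / (u t ^+ 2 + v t ^+ 2)
      - (cos t - p)); last by field.
    by rewrite e mulfK//; ring.
  have e : u t * (sin t - q) - v t * (cos t - p) = sin t * (u t ^+ 2 + v t ^+ 2).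
    by rewrite /u /v; ring: cs.
  transitivity ((u t * (sin t - q) - v t * (cos t - p)) / (u t ^+ 2 + v t ^+ 2)
    - (sin t - q)); last by field.
  by rewrite e mulfK//; ring.
have pi2 : 0 < 2 * pi :> R by rewrite mulr_gt0// pi_gt0.
have cu (t : R) : {for t, continuous u} by exact: is_derive1_continuous (du t).
have cv (t : R) : {for t, continuous v} by exact: is_derive1_continuous (dv t).
have cn (t : R) : {for t, continuous (fun t => (u t ^+ 2 + v t ^+ 2)^-1)}.
  apply: cvgV; first by rewrite gt_eqF.
  by apply: cvgD; rewrite /GRing.exp/=; apply: cvgM; (exact: cu || exact: cv).
have u2pi : u (2 * pi) = u 0 by rewrite /u mulr_natl cos2pi sin2pi cos0 sin0.
have v2pi : v (2 * pi) = v 0 by rewrite /v mulr_natl cos2pi sin2pi cos0 sin0.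
split.
  have := @has_int_ftc _ 0 (2 * pi) _ (fun t => atan (v t / u t)) pi2.
  rewrite u2pi v2pi subrr => h.
  apply: has_int_eq (h (fun t => u t / (u t ^+ 2 + v t ^+ 2) - 1) _ _).
  - by move=> t _; rewrite E.
  - move=> t _.
    apply: (is_derive_eq (is_derive_atan_div (lt0r_neq0 (u0 t)) (dv t) (du t))).
    have h0 : u t ^+ 2 + v t ^+ 2 != 0 by rewrite gt_eqF.
    by rewrite [v t ^+ 2 + _]addrC; field.
  - by move=> t _; apply: cvgB; [apply: cvgM; [exact: cu|exact: cn]|exact: cvg_cst].
have := @has_int_ftc _ 0 (2 * pi) _ (fun t => - (ln (u t ^+ 2 + v t ^+ 2) / 2)) pi2.
rewrite u2pi v2pi subrr => h.
apply: has_int_eq (h (fun t => - v t / (u t ^+ 2 + v t ^+ 2)) _ _).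
- by move=> t _; rewrite E.
- move=> t _.
  apply: (is_derive_eq (is_deriveN (is_derive_ln_norm2 (n0 t) (du t) (dv t)))).
  have h0 : u t ^+ 2 + v t ^+ 2 != 0 by rewrite gt_eqF.
  by field.
- by move=> t _; apply: cvgM; [apply: cvgN; exact: cv|exact: cn].
Qed.

Lemma has_cint_pole_out q : 1 < nsq q ->
  has_cint 0 (2 * pi : R) (fun t : R => q / (expi t - q)) (- (2 * pi : R)%:C).
Proof.
move=> q1.
have q0 : q != 0 by rewrite -nsq_gt0 (lt_trans ltr01 q1).
(* Reflection in the unit circle moves the pole inside: q / (w - q) = - 1 - conj (p / (w - p)) when
   w has modulus 1. The constant - 1 alone contributes. *)
pose p := (q^-1)^*.
have p1 : nsq p < 1 by rewrite nsq_conj nsqV invf_lt1 // (lt_trans ltr01 q1).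
have pi2 : 0 < 2 * pi :> R by rewrite mulr_gt0// pi_gt0.
have h1 := has_cintZ (-1) (has_cint_conj (has_cint_pole_in p1)).
have := has_cintD (has_cint_cst (-1) pi2) h1.
rewrite conjc0 mulr0 addr0 subr0 mulrN1.
apply: has_cint_eq => t _.
have w0 : expi t - q != 0.
  apply/eqP => /subr0_eq /(congr1 nsq); rewrite nsq_expi => h.
  by move: q1; rewrite -h ltxx.
have e0 := expi_neq0 t; have ew := conj_expi t.
set w := expi t in w0 e0 ew *; clearbody w.
rewrite rmorphM/= fmorphV rmorphB/= /p conjcK ew.
have : w^-1 - q^-1 != 0.
  by rewrite subr_eq0; apply: contra w0 => /eqP/invr_inj ->; rewrite subrr.
move=> h0.
have -> : w^-1 - q^-1 = (q - w) / (w * q) by field; rewrite ?e0 ?q0.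
have w1 : q - w != 0 by rewrite -opprB oppr_eq0.
by field; rewrite ?q0 ?e0 ?w0 ?w1.
Qed.

End HasCint.

(** * The inner integral *)

(** The numerator is [P / z] and [q1 - q2 = P * E / (d ^+ 2 * z)], so [P] cancels and only [E^-1]
    survives in front. Each summand is in the form q / (w - q) of the two pole lemmas. *)
Lemma edge_partial_fraction (F : fieldType) (a b c d z w E : F) :
  let P := a + b * z in
  let q1 := - (P - E) ^+ 2 / (4 * d ^+ 2 * z) in
  let q2 := - (P + E) ^+ 2 / (4 * d ^+ 2 * z) in
  (4 : F) != 0 -> d != 0 -> z != 0 -> w != 0 -> E != 0 -> P != 0 ->
  w - q1 != 0 -> w - q2 != 0 ->
  E ^+ 2 = P ^+ 2 + 4 * c * d * z ->
  (b + a / z) / (P ^+ 2 / z + (c + d * w) ^+ 2 / w) =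
  E^-1 * (q1 / (w - q1) + - (q2 / (w - q2))).
Proof.
move=> P q1 q2 n4 d0 z0 w0 E0 P0 w1 w2 hE.
have s12 : q1 + q2 = - (P ^+ 2 + 2 * c * d * z) / (d ^+ 2 * z).
  transitivity (- (2 * (P ^+ 2 + E ^+ 2)) / (4 * d ^+ 2 * z)).
    by rewrite /q1 /q2; field; rewrite ?n4 ?d0 ?z0.
  by rewrite hE; field; rewrite ?n4 ?d0 ?z0.
have m12 : q1 * q2 = c ^+ 2 / d ^+ 2.
  transitivity ((P ^+ 2 - E ^+ 2) ^+ 2 / (4 * d ^+ 2 * z) ^+ 2).
    by rewrite /q1 /q2; field; rewrite ?n4 ?d0 ?z0.
  by rewrite hE; field; rewrite ?n4 ?d0 ?z0.
have D : P ^+ 2 / z + (c + d * w) ^+ 2 / w = d ^+ 2 * ((w - q1) * (w - q2)) / w.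
  have -> : (w - q1) * (w - q2) = w ^+ 2 - (q1 + q2) * w + q1 * q2 by ring.
  by rewrite s12 m12; field; rewrite ?w0 ?d0 ?z0.
rewrite D.
have B : b + a / z = P / z by rewrite /P; field.
have -> : q1 / (w - q1) + - (q2 / (w - q2)) = (q1 - q2) * (w / ((w - q1) * (w - q2))).
  by field; rewrite ?w1 ?w2.
have -> : q1 - q2 = P * E / (d ^+ 2 * z).
  by rewrite /q1 /q2; field; rewrite ?n4 ?d0 ?z0.
by rewrite B; field; rewrite ?E0 ?d0 ?z0 ?w0 ?w1 ?w2.
Qed.

Section Inner.
Context {R : realType}.
Variables (a b c d : R) (z E : R[i]).
Hypotheses (d0 : 0 < d) (z1 : nsq z = 1).
Let P := a%:C + b%:C * z.
Hypotheses (hE : E ^+ 2 = P ^+ 2 + 4 * c%:C * d%:C * z)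
  (PE : 0 < complex.Re (P^* * E)).
Let q1 := - (P - E) ^+ 2 / (4 * d%:C ^+ 2 * z).
Let q2 := - (P + E) ^+ 2 / (4 * d%:C ^+ 2 * z).
Let s := nsq P + nsq E.
Let k := complex.Re (P^* * E).

Let f (t : R) := (b%:C + a%:C / z) /
  (P ^+ 2 / z + (c%:C + d%:C * expi t) ^+ 2 / expi t).

(** The hypothesis [PE] fixes the sign of the root [E]: it makes P - E smaller in modulus than P +
    E, so [q1] is the root nearer to the origin. *)
Let nsq_minus : nsq (P - E) = s - 2 * k.
Proof. by rewrite /s /k; case: P E => [p1 p2] [e1 e2]; rewrite /nsq/=; ring. Qed.

Let nsq_plus : nsq (P + E) = s + 2 * k.
Proof. by rewrite /s /k; case: P E => [p1 p2] [e1 e2]; rewrite /nsq/=; ring. Qed.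

Let nsq_real (x : R) : nsq x%:C = x ^+ 2.
Proof. by rewrite /nsq/= expr0n addr0. Qed.

Let nsq4 : nsq (4 : R[i]) = 16.
Proof.
have -> : (4 : R[i]) = (4 : R)%:C by rewrite rmorph_nat.
by rewrite nsq_real; ring.
Qed.

Let prod : (s - 2 * k) * (s + 2 * k) = 16 * (c * d) ^+ 2.
Proof.
rewrite -nsq_minus -nsq_plus -nsqM.
have -> : (P - E) * (P + E) = - (4 * c%:C * d%:C * z).
  by rewrite -subr_sqr hE; ring.
by rewrite nsqN !nsqM nsq4 z1 !nsq_real; ring.
Qed.

Let nsq_denom : nsq (4 * d%:C ^+ 2 * z) = (4 * d ^+ 2) ^+ 2.
Proof. by rewrite expr2 !nsqM nsq4 z1 !nsq_real; ring. Qed.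

Let nsq_q (x : R[i]) : nsq (- x ^+ 2 / (4 * d%:C ^+ 2 * z)) =
  (nsq x / (4 * d ^+ 2)) ^+ 2.
Proof.
by rewrite nsqM nsqV nsq_denom nsqN expr2 nsqM; field; rewrite gt_eqF.
Qed.

Let d4 : 0 < 4 * d ^+ 2. Proof. by rewrite mulr_gt0// exprn_gt0. Qed.

Let in_disk (x : R[i]) : nsq x < 4 * d ^+ 2 -> nsq (- x ^+ 2 / (4 * d%:C ^+ 2 * z)) < 1.
Proof.
move=> h; rewrite nsq_q expr_lt1// ?ltr_pdivrMr ?mul1r//.
by rewrite divr_ge0 ?nsq_ge0// ltW.
Qed.

Let out_disk (x : R[i]) : 4 * d ^+ 2 < nsq x -> 1 < nsq (- x ^+ 2 / (4 * d%:C ^+ 2 * z)).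
Proof.
move=> h; rewrite nsq_q expr_gt1// ?ltr_pdivlMr ?mul1r//.
by rewrite divr_ge0 ?nsq_ge0// ltW.
Qed.

Let fE : nsq q1 != 1 -> nsq q2 != 1 ->
  f =1 (fun t => E^-1 * (q1 / (expi t - q1) + -1 * (q2 / (expi t - q2)))).
Proof.
move=> h1 h2 t; rewrite mulN1r; apply: edge_partial_fraction => //.
- by rewrite -nsq_eq0 nsq_real expf_eq0/= gt_eqF.
- by rewrite -nsq_eq0 z1 oner_eq0.
- exact: expi_neq0.
- by apply: contraTneq PE => ->; rewrite mulr0 ltxx.
- by apply: contraTneq PE; rewrite /P => ->; rewrite rmorph0 mul0r ltxx.
- by apply: contra h1; rewrite subr_eq0 /q1 /P => /eqP <-; rewrite nsq_expi.
- by apply: contra h2; rewrite subr_eq0 /q2 /P => /eqP <-; rewrite nsq_expi.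
Qed.

(** The moduli of [q1] and [q2] are (s - 2 k) / (4 d^2) and (s + 2 k) / (4 d^2). Exactly one of them
    exceeds 1 when (4 d^2 - s - 2 k) (4 d^2 - s + 2 k) is negative, and by [prod] this product
    equals 8 d^2 (2 (c^2 + d^2) - s). *)
Lemma inner_integral_out : 2 * (c ^+ 2 + d ^+ 2) < nsq P + nsq E ->
  has_cint 0 (2 * pi : R) f ((2 * pi : R)%:C / E).
Proof.
rewrite -/s => hs.
have k0 : 0 < k by [].
have h : (4 * d ^+ 2 - s - 2 * k) * (4 * d ^+ 2 - s + 2 * k) < 0.
  have -> : (4 * d ^+ 2 - s - 2 * k) * (4 * d ^+ 2 - s + 2 * k) =
    16 * d ^+ 4 - 8 * d ^+ 2 * s + (s - 2 * k) * (s + 2 * k) by ring.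
  rewrite prod.
  have -> : 16 * d ^+ 4 - 8 * d ^+ 2 * s + 16 * (c * d) ^+ 2 =
    - (8 * d ^+ 2 * (s - 2 * (c ^+ 2 + d ^+ 2))) by ring.
  by rewrite oppr_lt0 mulr_gt0 ?subr_gt0// mulr_gt0// exprn_gt0.
have [h1 h2] : s - 2 * k < 4 * d ^+ 2 /\ 4 * d ^+ 2 < s + 2 * k.
  by split; rewrite ltNge; apply/negP => h'; nra.
have i1 : nsq q1 < 1 by apply: in_disk; rewrite nsq_minus.
have i2 : 1 < nsq q2 by apply: out_disk; rewrite nsq_plus.
have := has_cintZ E^-1 (has_cintD (has_cint_pole_in i1)
  (has_cintZ (-1) (has_cint_pole_out i2))).
rewrite (_ : E^-1 * _ = (2 * pi)%:C / E); last by rewrite mulN1r opprK add0r mulrC.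
by apply: has_cint_eq => t _; rewrite fE// ?(lt_eqF i1) ?(gt_eqF i2).
Qed.

(** Now that product is positive, so both roots lie on the same side of the unit circle and their
    contributions cancel. *)
Lemma inner_integral_in : nsq P + nsq E < 2 * (c ^+ 2 + d ^+ 2) ->
  has_cint 0 (2 * pi : R) f 0.
Proof.
rewrite -/s => hs.
have k0 : 0 < k by [].
have h : 0 < (4 * d ^+ 2 - s - 2 * k) * (4 * d ^+ 2 - s + 2 * k).
  have -> : (4 * d ^+ 2 - s - 2 * k) * (4 * d ^+ 2 - s + 2 * k) =
    16 * d ^+ 4 - 8 * d ^+ 2 * s + (s - 2 * k) * (s + 2 * k) by ring.
  rewrite prod.
  have -> : 16 * d ^+ 4 - 8 * d ^+ 2 * s + 16 * (c * d) ^+ 2 =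
    8 * d ^+ 2 * (2 * (c ^+ 2 + d ^+ 2) - s) by ring.
  by rewrite mulr_gt0 ?subr_gt0// mulr_gt0// exprn_gt0.
have [h1|h1] := ltP (s + 2 * k) (4 * d ^+ 2).
  have i1 : nsq q1 < 1 by apply: in_disk; rewrite nsq_minus; lra.
  have i2 : nsq q2 < 1 by apply: in_disk; rewrite nsq_plus.
  have := has_cintZ E^-1 (has_cintD (has_cint_pole_in i1)
    (has_cintZ (-1) (has_cint_pole_in i2))).
  rewrite mulr0 addr0 mulr0.
  by apply: has_cint_eq => t _; rewrite fE// ?(lt_eqF i1) ?(lt_eqF i2).
have h2 : 4 * d ^+ 2 < s - 2 * k by rewrite ltNge; apply/negP => h'; nra.
have i1 : 1 < nsq q1 by apply: out_disk; rewrite nsq_minus.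
have i2 : 1 < nsq q2 by apply: out_disk; rewrite nsq_plus; lra.
have := has_cintZ E^-1 (has_cintD (has_cint_pole_out i1)
  (has_cintZ (-1) (has_cint_pole_out i2))).
rewrite mulN1r opprK addNr mulr0.
by apply: has_cint_eq => t _; rewrite fE// ?(gt_eqF i1) ?(gt_eqF i2).
Qed.

End Inner.

(** * The branch of the square root *)

Section SquareRootBranch.
Context {R : realType}.
Variables (a b c d : R).
Hypotheses (a0 : 0 < a) (b0 : 0 < b) (c0 : 0 < c) (d0 : 0 < d).

(* With z = e^{it}, rad_re + i rad_im = (a + b z)^2 + 4 c d z, of norm rad_norm,
   and E = root_re + i root_im is its square root in the upper half-plane
   (root_re is the junk value 0 where root_im = 0). Moreover
   arg_re + i arg_im = 2 a^2 + root_mid z + 2 a E; edge_arg is t minus its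
   argument and edge_log is the logarithm of its modulus. *)
Definition root_mid : R := 2 * a * b + 4 * c * d.
Definition rad_re (t : R) := a ^+ 2 + root_mid * cos t + b ^+ 2 * (cos t ^+ 2 - sin t ^+ 2).
Definition rad_im (t : R) := root_mid * sin t + 2 * b ^+ 2 * sin t * cos t.
Definition rad_norm (t : R) := Num.sqrt (rad_re t ^+ 2 + rad_im t ^+ 2).
Definition root_im (t : R) := Num.sqrt ((rad_norm t - rad_re t) / 2).
Definition root_re (t : R) := rad_im t / (2 * root_im t).
Definition arg_re (t : R) := 2 * a ^+ 2 + root_mid * cos t + 2 * a * root_re t.
Definition arg_im (t : R) := root_mid * sin t + 2 * a * root_im t.
Definition edge_arg (t : R) := t - pi / 2 + atan (arg_re t / arg_im t).
Definition edge_log (t : R) := ln (arg_re t ^+ 2 + arg_im t ^+ 2) / 2.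

Notation beta := root_mid.
Notation Qr := rad_re.
Notation Qi := rad_im.
Notation N := rad_norm.
Notation y := root_im.
Notation x := root_re.
Notation u := arg_re.
Notation v := arg_im.

Lemma root_mid_gt0 : 0 < beta.
Proof. by rewrite addr_gt0// !mulr_gt0. Qed.

Lemma rad_norm_ge0 t : 0 <= N t. Proof. exact: sqrtr_ge0. Qed.

Lemma sqr_rad_norm t : N t ^+ 2 = Qr t ^+ 2 + Qi t ^+ 2.
Proof. by rewrite sqr_sqrtr// addr_ge0 ?sqr_ge0. Qed.

Lemma rad_re_le_norm t : `|Qr t| <= N t.
Proof. by rewrite -sqrtr_sqr ler_wsqrtr// lerDl sqr_ge0. Qed.

Lemma sqr_root_im t : y t ^+ 2 = (N t - Qr t) / 2.
Proof.
rewrite sqr_sqrtr// divr_ge0// subr_ge0.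
exact: le_trans (ler_norm _) (rad_re_le_norm t).
Qed.

Lemma root_re_im t : 0 < y t -> 2 * x t * y t = Qi t.
Proof. by move=> yt; rewrite /root_re; field; rewrite gt_eqF. Qed.

Lemma sqr_root_re t : 0 < y t -> x t ^+ 2 = (N t + Qr t) / 2.
Proof.
move=> yt.
have y2 : y t ^+ 2 != 0 by rewrite expf_eq0/= gt_eqF.
apply: (mulIf y2).
have -> : x t ^+ 2 * y t ^+ 2 = (2 * x t * y t) ^+ 2 / 4 by field.
rewrite root_re_im// sqr_root_im.
have -> : Qi t ^+ 2 = N t ^+ 2 - Qr t ^+ 2 by rewrite sqr_rad_norm addrC addKr.
by field.
Qed.

Lemma root_normE t : 0 < y t -> x t ^+ 2 + y t ^+ 2 = N t.
Proof. by move=> yt; rewrite sqr_root_re// sqr_root_im; field. Qed.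

Lemma root_sqr_re t : 0 < y t -> x t ^+ 2 - y t ^+ 2 = Qr t.
Proof. by move=> yt; rewrite sqr_root_re// sqr_root_im; field. Qed.

Lemma rad_norm_gt0 t : 0 < y t -> 0 < N t.
Proof. by move=> yt; rewrite -root_normE// ltr_wpDl ?sqr_ge0// exprn_gt0. Qed.

Lemma root_im_gt0 t : Qr t < N t -> 0 < y t.
Proof. by move=> h; rewrite sqrtr_gt0 divr_gt0// subr_gt0. Qed.

(** The radicand is never a nonnegative real on the open upper half circle: it is real only where
    [beta + 2 * b ^+ 2 * cos t] vanishes. There it equals a^2 - b^2, while [cos t >= -1] forces
    [beta <= 2 * b ^+ 2] and hence a < b. *)
Lemma sin_gt0_root_im t : 0 < sin t -> 0 < y t.
Proof.
move=> st; apply: root_im_gt0.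
have [h|h] := eqVneq (Qi t) 0; last first.
  apply: (le_lt_trans (ler_norm _)).
  rewrite -sqrtr_sqr ltr_sqrt ?ltrDl; last first.
    by rewrite ltr_wpDl ?sqr_ge0// lt_neqAle sqr_ge0 eq_sym expf_eq0 h.
  by rewrite lt_neqAle sqr_ge0 eq_sym expf_eq0 h.
apply: lt_le_trans (rad_norm_ge0 t).
have h1 : beta + 2 * b ^+ 2 * cos t = 0.
  move: h; rewrite /rad_im => /eqP.
  have -> : beta * sin t + 2 * b ^+ 2 * sin t * cos t = sin t * (beta + 2 * b ^+ 2 * cos t) by ring.
  by rewrite mulf_eq0 gt_eqF//= => /eqP.
have cs : sin t ^+ 2 = 1 - cos t ^+ 2 by rewrite -(cos2Dsin2 t) addrC addKr.
have -> : Qr t = a ^+ 2 - b ^+ 2 + cos t * (beta + 2 * b ^+ 2 * cos t).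
  by rewrite /rad_re cs; ring.
rewrite h1 mulr0 addr0 subr_lt0 ltr_sqr ?nnegrE ?ltW//.
have hc := cos_geN1 t; have b2 : 0 < b ^+ 2 by rewrite exprn_gt0.
have cd : 0 < c * d by rewrite mulr_gt0.
have : beta <= 2 * b ^+ 2 by nra.
rewrite /root_mid => h2; rewrite -(ltr_pM2r b0); lra.
Qed.

(** This positivity makes [pi / 2 - atan (arg_re t / arg_im t)] a continuous argument with values in
    (0, pi), which explains the form of [edge_arg]. *)
Lemma arg_im_gt0 t : 0 <= sin t -> 0 < y t -> 0 < v t.
Proof.
by move=> st yt; rewrite ltr_wpDl ?mulr_ge0 ?(ltW root_mid_gt0)// !mulr_gt0.
Qed.

Let dQr t : R := - beta * sin t - 4 * b ^+ 2 * sin t * cos t.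
Let dQi t : R := beta * cos t + 2 * b ^+ 2 * (cos t ^+ 2 - sin t ^+ 2).

Let is_derive_rad_re (t : R) : is_derive t 1 Qr (dQr t).
Proof. by rewrite /rad_re /dQr; apply: is_derive_eq; rewrite /GRing.scale/=; ring. Qed.

Let is_derive_rad_im (t : R) : is_derive t 1 Qi (dQi t).
Proof. by rewrite /rad_im /dQi; apply: is_derive_eq; rewrite /GRing.scale/=; ring. Qed.

(** With Q the radicand, E' = Q' / (2 E) = Q' conj(E) / (2 N), since N is the squared modulus of E.
    This is the imaginary part; [is_derive_root_re] is the real part. *)
Let is_derive_root_im (t : R) : 0 < y t ->
  is_derive t 1 y ((dQi t * x t - dQr t * y t) / (2 * N t)).
Proof.
move=> yt; have Nt := rad_norm_gt0 yt.
have n2 : 0 < Qr t ^+ 2 + Qi t ^+ 2 by rewrite -sqr_rad_norm exprn_gt0.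
have h1 : is_derive t 1 (fun s => Qr s ^+ 2 + Qi s ^+ 2) (2 * (Qr t * dQr t + Qi t * dQi t)).
  have hr := is_derive_rad_re t; have hi := is_derive_rad_im t.
  by apply: is_derive_eq; rewrite /GRing.scale/=; ring.
have h2 := @is_derive1_comp _ Num.sqrt (fun s => Qr s ^+ 2 + Qi s ^+ 2) t _ _ (is_derive1_sqrt n2) h1.
have h3 := is_deriveM (is_deriveB h2 (is_derive_rad_re t)) (is_derive_cst (2^-1 : R) t 1).
have y2 : 0 < (N t - Qr t) / 2 by rewrite -sqr_root_im exprn_gt0.
have h4 := @is_derive1_comp _ Num.sqrt (fun s => (N s - Qr s) / 2) t _ _ (is_derive1_sqrt y2) h3.
apply: (is_derive_eq h4).
rewrite /GRing.scale/= -/(N t) -/(y t) -(root_re_im yt) -(root_sqr_re yt) -(root_normE yt).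
have yn : y t != 0 by rewrite gt_eqF.
have Nn : x t ^+ 2 + y t ^+ 2 != 0 by rewrite root_normE// gt_eqF.
by field; rewrite Nn yn.
Qed.

Let is_derive_root_re (t : R) : 0 < y t ->
  is_derive t 1 x ((dQr t * x t + dQi t * y t) / (2 * N t)).
Proof.
move=> yt; have Nt := rad_norm_gt0 yt.
have y2 : 2 * y t != 0 by rewrite mulf_neq0// gt_eqF.
have h2 : is_derive t 1 (fun s => 2 * y s) (2 * ((dQi t * x t - dQr t * y t) / (2 * N t))).
  have h := is_derive_root_im yt.
  by apply: (is_derive_eq (is_deriveM (is_derive_cst (2 : R) t 1) h)); rewrite /GRing.scale/=; ring.
have h3 := is_deriveM (is_derive_rad_im t) (@is_deriveV _ (fun s => 2 * y s) t _ 1 y2 h2).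
suff h4 : is_derive t 1 (fun s => Qi s / (2 * y s)) ((dQr t * x t + dQi t * y t) / (2 * N t)) by exact: h4.
apply: (is_derive_eq h3).
rewrite /GRing.scale/= -(root_re_im yt) -(root_normE yt).
have yn : y t != 0 by rewrite gt_eqF.
have Nn : x t ^+ 2 + y t ^+ 2 != 0 by rewrite root_normE// gt_eqF.
by field; rewrite Nn yn.
Qed.

Lemma root_im_continuous : continuous y.
Proof.
move=> t.
have cr s : {for s, continuous Qr} := is_derive1_continuous (is_derive_rad_re s).
have ci s : {for s, continuous Qi} := is_derive1_continuous (is_derive_rad_im s).
have cN s : {for s, continuous N}.
  apply: (@continuous_comp _ _ _ (fun s => Qr s ^+ 2 + Qi s ^+ 2) Num.sqrt); last exact: sqrt_continuous.
  by apply: cvgD; rewrite /GRing.exp/=; apply: cvgM; (exact: cr || exact: ci).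
apply: (@continuous_comp _ _ _ (fun s => (N s - Qr s) / 2) Num.sqrt); last exact: sqrt_continuous.
by apply: cvgM; [apply: cvgB; [exact: cN|exact: cr]|exact: cvg_cst].
Qed.

(** This is the absolute value of [root_re] wherever [root_im] is positive. It is continuous also at
    0 and pi, where [root_re] may be junk, and replaces it in the limits. *)
Lemma sqrt_rad_continuous : continuous (fun t => Num.sqrt ((N t + Qr t) / 2)).
Proof.
move=> t.
have cr s : {for s, continuous Qr} := is_derive1_continuous (is_derive_rad_re s).
have ci s : {for s, continuous Qi} := is_derive1_continuous (is_derive_rad_im s).
have cN s : {for s, continuous N}.
  apply: (@continuous_comp _ _ _ (fun s => Qr s ^+ 2 + Qi s ^+ 2) Num.sqrt); last exact: sqrt_continuous.
  by apply: cvgD; rewrite /GRing.exp/=; apply: cvgM; (exact: cr || exact: ci).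
apply: (@continuous_comp _ _ _ (fun s => (N s + Qr s) / 2) Num.sqrt); last exact: sqrt_continuous.
by apply: cvgM; [apply: cvgD; [exact: cN|exact: cr]|exact: cvg_cst].
Qed.

Section Derivatives.
Variable t : R.
Hypotheses (st : 0 <= sin t) (yt : 0 < y t).

Let du : R := - beta * sin t + 2 * a * ((dQr t * x t + dQi t * y t) / (2 * N t)).
Let dv : R := beta * cos t + 2 * a * ((dQi t * x t - dQr t * y t) / (2 * N t)).

Lemma is_derive_arg_re : is_derive t 1 u du.
Proof.
have h := is_derive_root_re yt.
have h2 := is_deriveM (is_derive_cst (2 * a : R) t 1) h.
have h1 : is_derive t 1 (fun s => 2 * a ^+ 2 + beta * cos s) (- beta * sin t).
  by apply: is_derive_eq; rewrite /GRing.scale/=; ring.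
by apply: (is_derive_eq (is_deriveD h1 h2)); rewrite /GRing.scale/= /du; ring.
Qed.

Lemma is_derive_arg_im : is_derive t 1 v dv.
Proof.
have h := is_derive_root_im yt.
have h2 := is_deriveM (is_derive_cst (2 * a : R) t 1) h.
have h1 : is_derive t 1 (fun s => beta * sin s) (beta * cos t).
  by apply: is_derive_eq; rewrite /GRing.scale/=; ring.
by apply: (is_derive_eq (is_deriveD h1 h2)); rewrite /GRing.scale/= /dv; ring.
Qed.

(* With G = arg_re + i arg_im and E = root_re + i root_im, differentiating
   E^2 = a^2 + beta z + b^2 z^2 gives E (G + i G') = a G. *)
Let ode_re : x t * (u t - dv) - y t * (v t + du) = a * u t.
Proof.
have Nn : x t ^+ 2 + y t ^+ 2 != 0 by rewrite root_normE// gt_eqF// rad_norm_gt0.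
have e : x t * dv + y t * du = beta * (x t * cos t - y t * sin t) + a * dQi t.
  by rewrite /du /dv -root_normE//; field.
transitivity (x t * u t - y t * v t - (x t * dv + y t * du)); first by ring.
rewrite e /arg_re /arg_im.
transitivity (2 * a ^+ 2 * x t + 2 * a * (x t ^+ 2 - y t ^+ 2) - a * dQi t); first by ring.
by rewrite root_sqr_re// /rad_re /dQi; ring.
Qed.

Let ode_im : x t * (v t + du) + y t * (u t - dv) = a * v t.
Proof.
have Nn : x t ^+ 2 + y t ^+ 2 != 0 by rewrite root_normE// gt_eqF// rad_norm_gt0.
have e : x t * du - y t * dv = - beta * (x t * sin t + y t * cos t) + a * dQr t.
  by rewrite /du /dv -root_normE//; field.
transitivity (x t * v t + y t * u t + (x t * du - y t * dv)); first by ring.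
rewrite e /arg_re /arg_im.
transitivity (2 * a ^+ 2 * y t + 2 * a * (2 * x t * y t) + a * dQr t); first by ring.
by rewrite root_re_im// /rad_im /dQr; ring.
Qed.

Let vt : 0 < v t := arg_im_gt0 st yt.

Let n0 : u t ^+ 2 + v t ^+ 2 != 0.
Proof. by rewrite gt_eqF// ltr_wpDl ?sqr_ge0// exprn_gt0. Qed.

(** Solving the relation E (G + i G') = a G by multiplication with conj(E) gives G + i G' = a G
    conj(E) / N; [diff_re] and [diff_im] are its two parts. *)
Let diff_re : u t - dv = a * (u t * x t + v t * y t) / N t.
Proof.
have Nn : N t != 0 by rewrite gt_eqF// rad_norm_gt0.
apply: (mulIf Nn); rewrite divfK// -{1}root_normE//.
transitivity (x t * (x t * (u t - dv) - y t * (v t + du)) +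
  y t * (x t * (v t + du) + y t * (u t - dv))); first by ring.
by rewrite ode_re ode_im; ring.
Qed.

Let diff_im : v t + du = a * (v t * x t - u t * y t) / N t.
Proof.
have Nn : N t != 0 by rewrite gt_eqF// rad_norm_gt0.
apply: (mulIf Nn); rewrite divfK// -{1}root_normE//.
transitivity (x t * (x t * (v t + du) + y t * (u t - dv)) -
  y t * (x t * (u t - dv) - y t * (v t + du))); first by ring.
by rewrite ode_re ode_im; ring.
Qed.

(** 1 + i G' / G = (G + i G') / G = a / E. The real part is the derivative of [edge_arg], the
    imaginary part that of [edge_log]. *)
Lemma is_derive_edge_arg : is_derive t 1 edge_arg (a * x t / N t).
Proof.
have Nn : N t != 0 by rewrite gt_eqF// rad_norm_gt0.
have h := is_derive_atan_div (lt0r_neq0 vt) is_derive_arg_re is_derive_arg_im.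
have h1 : is_derive t 1 (fun s : R => s - pi / 2) 1.
  by apply: is_derive_eq; rewrite subr0.
apply: (is_derive_eq (is_deriveD h1 h)).
transitivity ((u t * (u t - dv) + v t * (v t + du)) / (u t ^+ 2 + v t ^+ 2)).
  by field.
by rewrite diff_re diff_im; field; rewrite n0 Nn.
Qed.

Lemma is_derive_edge_log : is_derive t 1 edge_log (- a * y t / N t).
Proof.
have Nn : N t != 0 by rewrite gt_eqF// rad_norm_gt0.
have n1 : 0 < u t ^+ 2 + v t ^+ 2 by rewrite ltr_wpDl ?sqr_ge0// exprn_gt0.
apply: (is_derive_eq (is_derive_ln_norm2 n1 is_derive_arg_re is_derive_arg_im)).
transitivity ((u t * (v t + du) - v t * (u t - dv)) / (u t ^+ 2 + v t ^+ 2)).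
  by congr (_ / _); ring.
by rewrite diff_re diff_im; field; rewrite n0 Nn.
Qed.

Lemma root_ratio_continuous :
  {for t, continuous (fun s => x s / N s)} /\ {for t, continuous (fun s => y s / N s)}.
Proof.
have Nn : N t != 0 by rewrite gt_eqF// rad_norm_gt0.
have cx : {for t, continuous x} := is_derive1_continuous (is_derive_root_re yt).
have cr : {for t, continuous Qr} := is_derive1_continuous (is_derive_rad_re t).
have ci : {for t, continuous Qi} := is_derive1_continuous (is_derive_rad_im t).
have cN : {for t, continuous N}.
  apply: (@continuous_comp _ _ _ (fun s => Qr s ^+ 2 + Qi s ^+ 2) Num.sqrt); last exact: sqrt_continuous.
  by apply: cvgD; rewrite /GRing.exp/=; apply: cvgM; (exact: cr || exact: ci).
by split; (apply: cvgM; [|apply: cvgV; [exact: Nn|exact: cN]]); [exact: cx|exact: root_im_continuous].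
Qed.

End Derivatives.

End SquareRootBranch.

(** * Reflection of the variable and one-sided limits *)

Section Limits.
Context {R : realType}.
Implicit Types (f F : R -> R) (a b c m l la lb : R).

Lemma cvg_reflect_left c a F l :
  F t @[t --> a^'+] --> l -> F (c - t) @[t --> (c - a)^'-] --> l.
Proof.
move=> h; apply: (cvg_comp (fun t => c - t) F _ h) => A [e /= e0 H].
exists e => //= y; rewrite /ball_/= => hy yc; apply: H => /=; last by lra.
by rewrite /ball_/= (_ : a - (c - y) = - (c - a - y)) ?normrN//; ring.
Qed.

Lemma cvg_reflect_right c b F l :
  F t @[t --> b^'-] --> l -> F (c - t) @[t --> (c - b)^'+] --> l.
Proof.
move=> h; apply: (cvg_comp (fun t => c - t) F _ h) => A [e /= e0 H].
exists e => //= y; rewrite /ball_/= => hy yc; apply: H => /=; last by lra.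
by rewrite /ball_/= (_ : b - (c - y) = - (c - b - y)) ?normrN//; ring.
Qed.

Lemma has_int_ftc_reflect c a m b f F la lb : a <= m -> m <= b -> a < b ->
  (forall t, t \in `]a, b[ -> is_derive t 1 F (f t)) ->
  (forall t, t \in `]a, b[ -> {for t, continuous f}) ->
  (forall t, t \in `]a, m[ -> 0 <= f t) ->
  (forall t, t \in `]m, b[ -> f t <= 0) ->
  F t @[t --> a^'+] --> la -> F t @[t --> b^'-] --> lb ->
  has_int (c - b) (c - a) (fun t => f (c - t)) (lb - la).
Proof.
move=> am mb ab dF cf f0 f1 Fa Fb.
have i1 t : t \in `](c - b), (c - a)[ -> c - t \in `]a, b[ by rewrite !in_itv/=; lra.
have i2 t : t \in `](c - b), (c - m)[ -> c - t \in `]m, b[ by rewrite !in_itv/=; lra.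
have i3 t : t \in `](c - m), (c - a)[ -> c - t \in `]a, m[ by rewrite !in_itv/=; lra.
have dr (t : R) : is_derive t 1 (fun s => c - s) (-1).
  by apply: is_derive_eq; first [ring | rewrite add0r].
have cr (t : R) : {for t, continuous (fun s : R => c - s)} := is_derive1_continuous (dr t).
have h1 : c - b <= c - m by lra.
have h2 : c - m <= c - a by lra.
have h3 : c - b < c - a by lra.
have D t : t \in `](c - b), (c - a)[ -> is_derive t 1 (fun s => F (c - s)) (- f (c - t)).
  move=> /i1 /dF h; apply: (is_derive_eq (@is_derive1_comp _ F (fun s => c - s) t _ _ h (dr t))).
  by rewrite mulrN1.
have C t : t \in `](c - b), (c - a)[ -> {for t, continuous (fun s => - f (c - s))}.
  move=> /i1 /cf h; apply: cvgN.
  exact: (@continuous_comp _ _ _ (fun s => c - s) f t (cr t) h).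
have S0 t : t \in `](c - b), (c - m)[ -> 0 <= - f (c - t).
  by move=> /i2 /f1; rewrite oppr_ge0.
have S1 t : t \in `](c - m), (c - a)[ -> - f (c - t) <= 0.
  by move=> /i3 /f0; rewrite oppr_le0.
have := has_int_ftc_ge0_le0 h1 h2 h3 D C S0 S1 (cvg_reflect_right c Fb) (cvg_reflect_left c Fa).
move=> /(has_intZ (-1)); rewrite (_ : -1 * (la - lb) = lb - la); last by ring.
by apply: has_int_eq => t _; rewrite mulN1r opprK.
Qed.

Lemma cvg_atan_div_pos (T : Type) (F : set_system T) (FF : Filter F)
    (u v : T -> R) (u0 : R) :
  0 < u0 -> u @ F --> u0 -> v @ F --> 0 -> (\forall t \near F, 0 < v t) ->
  atan (u t / v t) @[t --> F] --> pi / 2.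
Proof.
move=> u0p hu hv vp.
suff h : u t / v t @[t --> F] --> +oo.
  have h2 := cvg_comp (fun t => u t / v t) (@atan R) h (@cvgy_atan R).
  exact: h2.
apply/cvgryPgt => A.
have e0 : 0 < u0 / 2 / (`|A| + 1).
  by rewrite divr_gt0 ?divr_gt0// ltr_wpDl.
have h1 : \forall t \near F, u0 / 2 < u t.
  by apply: (cvgr_gt u0) => //; rewrite ltr_pdivrMr// ltr_pMr// ltr1n.
have h2 : \forall t \near F, v t < u0 / 2 / (`|A| + 1) by exact: (cvgr_lt 0).
near=> t.
have vt : 0 < v t by near: t.
have ut : u0 / 2 < u t by near: t.
have vt2 : v t < u0 / 2 / (`|A| + 1) by near: t.
rewrite ltr_pdivlMr//.
move: vt2; rewrite ltr_pdivlMr ?ltr_wpDl// => vt2.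
have := ler_norm A; nra.
Unshelve. all: by end_near. Qed.

End Limits.

(** * The outer integral *)

Section EdgeLimits.
Context {R : realType}.
Variables (a b c d : R).
Hypotheses (a0 : 0 < a) (b0 : 0 < b) (c0 : 0 < c) (d0 : 0 < d).

Notation beta := (root_mid a b c d).
Notation Qr := (rad_re a b c d).
Notation N := (rad_norm a b c d).
Notation y := (root_im a b c d).
Notation x := (root_re a b c d).
Notation u := (arg_re a b c d).
Notation v := (arg_im a b c d).

(** Since 2 x y is the imaginary part of the radicand and y > 0, the sign of [x t] is that of
    [beta + 2 * b ^+ 2 * cos t]. *)
Lemma root_re_sign (t : R) : 0 < sin t ->
  (0 <= beta + 2 * b ^+ 2 * cos t -> x t = Num.sqrt ((N t + Qr t) / 2)) /\
  (beta + 2 * b ^+ 2 * cos t <= 0 -> x t = - Num.sqrt ((N t + Qr t) / 2)).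
Proof.
move=> st; have yt := sin_gt0_root_im a0 b0 c0 d0 st.
have Ex : x t = sin t * (beta + 2 * b ^+ 2 * cos t) / (2 * y t).
  by rewrite /root_re /rad_im; congr (_ / _); ring.
rewrite -sqr_root_re// sqrtr_sqr; split=> h.
  rewrite ger0_norm// Ex; apply: divr_ge0; last by rewrite mulr_ge0// ltW.
  by apply: mulr_ge0 => //; exact: ltW.
rewrite ler0_norm ?opprK// Ex ler_pdivrMr ?mulr_gt0// mul0r.
by apply: mulr_ge0_le0 => //; exact: ltW.
Qed.

Variables (F : set_system R) (FF : ProperFilter F) (t0 : R).
Hypotheses (Ft0 : t @[t --> F] --> t0) (sinF : \forall t \near F, 0 < sin t).

(** At such an end [arg_im] tends to 0 from above, so the argument of arg_re + i arg_im tends to 0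
    or pi according to the sign of the limit [u0] of [arg_re]. The factor [s], used with 1 and -1,
    records the sign of [root_re] near [t0]. *)
Lemma edge_arg_cvg (s : R) (x0 := s * Num.sqrt ((N t0 + Qr t0) / 2))
    (u0 := 2 * a ^+ 2 + beta * cos t0 + 2 * a * x0) :
  (\forall t \near F, x t = s * Num.sqrt ((N t + Qr t) / 2)) ->
  sin t0 = 0 -> y t0 = 0 -> u0 != 0 ->
  edge_arg a b c d t @[t --> F] --> (if 0 < u0 then t0 else t0 - pi) /\
  edge_log a b c d t @[t --> F] --> ln (u0 ^+ 2) / 2.
Proof.
move=> hx st0 yt0 un0.
have cy : y t @[t --> F] --> 0.
  by rewrite -yt0; apply: (cvg_comp _ _ Ft0); exact: root_im_continuous.
have csin : sin t @[t --> F] --> 0.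
  by rewrite -st0; apply: (cvg_comp _ _ Ft0); exact: continuous_sin.
have ccos : cos t @[t --> F] --> cos t0.
  by apply: (cvg_comp _ _ Ft0); exact: continuous_cos.
have cx : x t @[t --> F] --> x0.
  have h : s * Num.sqrt ((N t + Qr t) / 2) @[t --> F] --> x0.
    apply: cvgM; first exact: cvg_cst.
    apply: (cvg_comp (fun t => t) (fun t => Num.sqrt ((N t + Qr t) / 2)) Ft0).
    exact: sqrt_rad_continuous.
  apply: cvg_trans h; apply: near_eq_cvg; near=> t.
  by apply/esym; near: t.
have cu : u t @[t --> F] --> u0.
  apply: cvgD; last by apply: cvgM cx; exact: cvg_cst.
  by apply: cvgD; [exact: cvg_cst|apply: cvgM ccos; exact: cvg_cst].
have cv : v t @[t --> F] --> 0.
  rewrite -[X in _ --> X](_ : beta * 0 + 2 * a * 0 = 0); last by rewrite !mulr0 addr0.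
  by apply: cvgD; apply: cvgM => //; exact: cvg_cst.
have vp : \forall t \near F, 0 < v t.
  near=> t; have st : 0 < sin t by near: t.
  by apply: arg_im_gt0 => //; [exact: ltW|exact: sin_gt0_root_im].
split.
  case: ifPn => [u0p|]; last rewrite -leNgt => u0n.
    rewrite (_ : t0 = t0 - pi / 2 + pi / 2); last by rewrite subrK.
    apply: cvgD; first by apply: cvgB => //; exact: cvg_cst.
    exact: (cvg_atan_div_pos FF u0p cu cv vp).
  have u0p : 0 < - u0 by rewrite oppr_gt0 lt_neqAle un0.
  rewrite (_ : t0 - pi = t0 - pi / 2 - pi / 2); last by field.
  apply: cvgD; first by apply: cvgB => //; exact: cvg_cst.
  have h : atan (- u t / v t) @[t --> F] --> pi / 2.
    exact: (cvg_atan_div_pos FF u0p (cvgN cu) cv vp).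
  have -> : (fun t => atan (u t / v t)) = (fun t => - atan (- u t / v t)).
    by apply/funext => t; rewrite mulNr atanN opprK.
  exact: cvgN.
apply: cvgM; last exact: cvg_cst.
have cn : u t ^+ 2 + v t ^+ 2 @[t --> F] --> u0 ^+ 2.
  rewrite -[X in _ --> X](_ : u0 * u0 + 0 * 0 = u0 ^+ 2); last by rewrite mul0r addr0.
  by apply: cvgD; rewrite /GRing.exp/=; apply: cvgM.
apply: (cvg_comp _ _ cn); apply: continuous_ln.
by rewrite lt_neqAle sqr_ge0 eq_sym expf_eq0/= un0.
Unshelve. all: by end_near. Qed.

End EdgeLimits.

Section Outer.
Context {R : realType}.
Variables (a b c d : R).
Hypotheses (a0 : 0 < a) (b0 : 0 < b) (c0 : 0 < c) (d0 : 0 < d).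

Notation Qr := (rad_re a b c d).
Notation Qi := (rad_im a b c d).
Notation N := (rad_norm a b c d).
Notation y := (root_im a b c d).
Notation x := (root_re a b c d).
Notation E t := (x t +i* y t).
Notation P t := (a%:C + b%:C * expi t).

(* Affine in [X], with positive slope; it vanishes at the cosine of the angle
   for which a root of the inner denominator reaches the unit circle. *)
Definition crit (X : R) : R :=
  (c ^+ 2 + d ^+ 2) * (a ^+ 2 + b ^+ 2 + 2 * a * b * X) +
  2 * c * d * (2 * a * b + (a ^+ 2 + b ^+ 2) * X) - (c ^+ 2 - d ^+ 2) ^+ 2.

(** The inner integral is decided by comparing r + N with 2 (c^2 + d^2), r being the squared modulus
    of P. Isolating N and squaring turns this into the sign of [crit]. *)
Lemma sqr_rad_normE (t : R) (r := a ^+ 2 + b ^+ 2 + 2 * a * b * cos t) :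
  N t ^+ 2 = (2 * (c ^+ 2 + d ^+ 2) - r) ^+ 2 + 4 * crit (cos t).
Proof.
have cs : sin t ^+ 2 = 1 - cos t ^+ 2 by rewrite -(cos2Dsin2 t) addrC addKr.
by rewrite sqr_rad_norm /rad_re /rad_im /root_mid /crit /r; ring: cs.
Qed.

Lemma nsq_side (t : R) : nsq (P t) = a ^+ 2 + b ^+ 2 + 2 * a * b * cos t.
Proof.
have cs : sin t ^+ 2 = 1 - cos t ^+ 2 by rewrite -(cos2Dsin2 t) addrC addKr.
by rewrite /nsq/=; ring: cs.
Qed.

Lemma crit_gt0 (t : R) : 0 < sin t -> 0 < crit (cos t) ->
  2 * (c ^+ 2 + d ^+ 2) < nsq (P t) + nsq (E t).
Proof.
move=> st ct; have yt := sin_gt0_root_im a0 b0 c0 d0 st.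
have -> : nsq (E t) = N t by rewrite /nsq/= root_normE.
rewrite nsq_side.
have := sqr_rad_normE t; have := rad_norm_ge0 a b c d t.
set r := a ^+ 2 + b ^+ 2 + 2 * a * b * cos t; set n := N t => n0 hn.
have : (2 * (c ^+ 2 + d ^+ 2) - r) ^+ 2 < n ^+ 2 by rewrite hn ltrDl mulr_gt0.
move=> h; rewrite ltNge; apply/negP => h'.
have h1 : n <= 2 * (c ^+ 2 + d ^+ 2) - r by lra.
by move: h; rewrite ltNge ler_sqr ?nnegrE ?h1// (le_trans n0).
Qed.

Lemma crit_lt0 (t : R) : 0 < sin t -> crit (cos t) < 0 ->
  nsq (P t) + nsq (E t) < 2 * (c ^+ 2 + d ^+ 2).
Proof.
move=> st ct; have yt := sin_gt0_root_im a0 b0 c0 d0 st.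
have -> : nsq (E t) = N t by rewrite /nsq/= root_normE.
rewrite nsq_side.
have := sqr_rad_normE t; have := rad_norm_ge0 a b c d t.
move: ct; rewrite /crit.
set r := a ^+ 2 + b ^+ 2 + 2 * a * b * cos t.
set m := 2 * a * b + (a ^+ 2 + b ^+ 2) * cos t; set n := N t => ct n0 hn.
have mr : 0 <= r + m.
  have -> : r + m = (a + b) ^+ 2 * (1 + cos t) by rewrite /r /m; ring.
  by rewrite mulr_ge0 ?sqr_ge0//; have := cos_geN1 t; lra.
have [h|h] := ltP r (2 * (c ^+ 2 + d ^+ 2)).
  have : n ^+ 2 < (2 * (c ^+ 2 + d ^+ 2) - r) ^+ 2 by rewrite hn; lra.
  by rewrite ltr_sqr ?nnegrE//; lra.
(* Squaring is conclusive only when r < 2 (c^2 + d^2). Otherwise crit = (c - d)^2 r + 2 c d (r + m)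
   - (c^2 - d^2)^2 is at least (c - d)^4, against its negativity. *)
exfalso.
have h1 : 0 <= 2 * c * d * (r + m) by rewrite !mulr_ge0// ltW.
have h2 : 0 <= (c - d) ^+ 2 * (r - 2 * (c ^+ 2 + d ^+ 2)).
  by rewrite mulr_ge0 ?sqr_ge0// subr_ge0.
have h3 : 0 <= ((c - d) ^+ 2) ^+ 2 by exact: sqr_ge0.
move: ct h1 h2 h3; nra.
Qed.

Lemma root_sqrE (t : R) : 0 < sin t ->
  E t ^+ 2 = P t ^+ 2 + 4 * c%:C * d%:C * expi t.
Proof.
move=> st; have yt := sin_gt0_root_im a0 b0 c0 d0 st.
have -> : 4 * c%:C * d%:C = (4 * c * d)%:C :> R[i] by rewrite !rmorphM/= rmorph_nat.
apply/eqP; rewrite eq_complex/=; apply/andP; split; apply/eqP.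
  transitivity (x t ^+ 2 - y t ^+ 2); first by ring.
  by rewrite root_sqr_re// /rad_re /root_mid; ring.
transitivity (2 * x t * y t); first by ring.
by rewrite root_re_im// /rad_im /root_mid; ring.
Qed.

(** Multiplied by 2 y > 0, the expression involves the root only through 2 x y and y^2, that is,
    through the radicand and its norm. It becomes [sin t] times the sum b |P|^2 + 4 a c d + b N of
    nonnegative terms, the middle one positive. *)
Lemma root_branch (t : R) : 0 < sin t -> 0 < complex.Re ((P t)^* * E t).
Proof.
move=> st; have yt := sin_gt0_root_im a0 b0 c0 d0 st.
have cs : sin t ^+ 2 = 1 - cos t ^+ 2 by rewrite -(cos2Dsin2 t) addrC addKr.
have -> : complex.Re ((P t)^* * E t) = (a + b * cos t) * x t + b * sin t * y t.
  by rewrite /=; ring.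
rewrite -(pmulr_rgt0 _ (mulr_gt0 (ltr0n R 2) yt)).
have -> : 2 * y t * ((a + b * cos t) * x t + b * sin t * y t) =
  (a + b * cos t) * (2 * x t * y t) + 2 * b * sin t * y t ^+ 2 by ring.
rewrite root_re_im// sqr_root_im.
have -> : (a + b * cos t) * Qi t + 2 * b * sin t * ((N t - Qr t) / 2) =
  sin t * (b * (a ^+ 2 + b ^+ 2 + 2 * a * b * cos t) + 4 * a * c * d + b * N t).
  have -> : 2 * b * sin t * ((N t - Qr t) / 2) = b * sin t * (N t - Qr t) by field.
  by rewrite /rad_im /rad_re /root_mid; ring: cs.
rewrite mulr_gt0// ltr_wpDr ?mulr_ge0 ?rad_norm_ge0 ?(ltW b0)//.
rewrite ltr_wpDl ?mulr_gt0// -nsq_side mulr_ge0 ?nsq_ge0// ltW//.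
Qed.

(** The data at 2 pi - t are the conjugates of those at t, so conj(E) meets the requirements of the
    inner integral on the lower half circle. *)
Lemma root_conj (t : R) : 0 < sin t ->
  [/\ nsq (expi t)^* = 1, a%:C + b%:C * (expi t)^* = (P t)^*,
      (E t)^* ^+ 2 = (a%:C + b%:C * (expi t)^*) ^+ 2 + 4 * c%:C * d%:C * (expi t)^* &
      0 < complex.Re ((a%:C + b%:C * (expi t)^*)^* * (E t)^*)].
Proof.
move=> st; have PE : a%:C + b%:C * (expi t)^* = (P t)^*.
  by apply/eqP; rewrite eq_complex/=; apply/andP; split; apply/eqP; ring.
rewrite PE; split=> //.
- by rewrite nsq_conj nsq_expi.
- have -> : 4 * c%:C * d%:C * (expi t)^* = (4 * c%:C * d%:C * expi t)^*.
    have -> : 4 * c%:C * d%:C = (4 * c * d)%:C :> R[i] by rewrite !rmorphM/= rmorph_nat.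
    by apply/eqP; rewrite eq_complex/=; apply/andP; split; apply/eqP; ring.
  by rewrite -!rmorphXn root_sqrE// rmorphD.
- by rewrite -rmorphM; have := root_branch st; case: (_ * _).
Qed.

Lemma edge_integrandE (t p : R) : edge_integrand a b c d t p =
  (b%:C + a%:C / expi t) /
  (P t ^+ 2 / expi t + (c%:C + d%:C * expi p) ^+ 2 / expi p).
Proof. by rewrite /edge_integrand !expiN !conj_expi. Qed.

Lemma expi_reflect (t : R) : expi (2 * pi - t) = (expi t)^*.
Proof.
by rewrite -expiN /expi mulr_natl addrC cosD2pi sinD2pi.
Qed.

Lemma cint_edge_out (t : R) : 0 < sin t -> 0 < crit (cos t) ->
  cint (edge_integrand a b c d t) = (2 * pi : R)%:C / E t /\
  cint (edge_integrand a b c d (2 * pi - t)) = (2 * pi : R)%:C / (E t)^*.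
Proof.
move=> st ct; have h := crit_gt0 st ct.
have hE := root_sqrE st; have hk := root_branch st.
split; apply: has_cint_cint.
  have := inner_integral_out d0 (nsq_expi t) hE hk h.
  by apply: has_cint_eq => p _; rewrite edge_integrandE.
have [z1 PE hE' hk'] := root_conj st.
have h' : 2 * (c ^+ 2 + d ^+ 2) < nsq (a%:C + b%:C * (expi t)^*) + nsq (E t)^*.
  by rewrite PE !nsq_conj.
have := inner_integral_out d0 z1 hE' hk' h'.
by apply: has_cint_eq => p _; rewrite edge_integrandE expi_reflect.
Qed.

Lemma cint_edge_in (t : R) : 0 < sin t -> crit (cos t) < 0 ->
  cint (edge_integrand a b c d t) = 0 /\
  cint (edge_integrand a b c d (2 * pi - t)) = 0.
Proof.
move=> st ct; have h := crit_lt0 st ct.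
have hE := root_sqrE st; have hk := root_branch st.
split; apply: has_cint_cint.
  have := inner_integral_in d0 (nsq_expi t) hE hk h.
  by apply: has_cint_eq => p _; rewrite edge_integrandE.
have [z1 PE hE' hk'] := root_conj st.
have h' : nsq (a%:C + b%:C * (expi t)^*) + nsq (E t)^* < 2 * (c ^+ 2 + d ^+ 2).
  by rewrite PE !nsq_conj.
have := inner_integral_in d0 z1 hE' hk' h'.
by apply: has_cint_eq => p _; rewrite edge_integrandE expi_reflect.
Qed.

End Outer.

(** * The outer integral from the endpoint limits of its primitive *)

Section Evaluation.
Context {R : realType}.
Variables (a b c d : R).
Hypotheses (a0 : 0 < a) (b0 : 0 < b) (c0 : 0 < c) (d0 : 0 < d).

Notation beta := (root_mid a b c d).
Notation Qr := (rad_re a b c d).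
Notation Qi := (rad_im a b c d).
Notation N := (rad_norm a b c d).
Notation y := (root_im a b c d).
Notation x := (root_re a b c d).
Notation E t := (x t +i* y t).
Notation edge_arg := (edge_arg a b c d).
Notation edge_log := (edge_log a b c d).
Notation crit := (crit a b c d).

Let beta0 : 0 < beta := root_mid_gt0 a0 b0 c0 d0.
Let pi0 : 0 < pi :> R := pi_gt0 R.

Lemma rad_norm_real (t : R) : Qi t = 0 -> N t = `|Qr t|.
Proof. by move=> h; rewrite /rad_norm h expr0n addr0 sqrtr_sqr. Qed.

Lemma root_im_real (t : R) : Qi t = 0 -> 0 <= Qr t -> y t = 0.
Proof. by move=> h1 h2; rewrite /root_im rad_norm_real// ger0_norm// subrr mul0r sqrtr0. Qed.

(** At 0 the radicand is a positive real and the limit of arg_re + i arg_im is positive, so the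
    lower end contributes no angle. Only the existence of the limit of [edge_log] matters, as it
    cancels later. *)
Lemma edge_arg_at0 : edge_arg t @[t --> 0^'+] --> 0 /\
  exists K : R, edge_log t @[t --> 0^'+] --> K.
Proof.
have st0 : sin (0 : R) = 0 by exact: sin0.
have Qr0 : 0 <= Qr 0.
  rewrite /rad_re cos0 sin0.
  have -> : a ^+ 2 + beta * 1 + b ^+ 2 * (1 ^+ 2 - 0 ^+ 2) = a ^+ 2 + beta + b ^+ 2 by ring.
  apply: addr_ge0; last exact: sqr_ge0.
  by apply: addr_ge0; [exact: sqr_ge0|exact: ltW].
have yt0 : y 0 = 0 by apply: root_im_real => //; rewrite /rad_im sin0; ring.
have cvg0 : (fun t : R => t) @ 0^'+ --> (0 : R) by apply: cvg_at_right_filter; exact: cvg_id.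
have sF : \forall t \near 0^'+, 0 < sin (t : R).
  near=> t; apply: sin_gt0_pi; apply/andP; split; near: t.
    exact: nbhs_right_gt.
  exact: nbhs_right_lt.
have hx : \forall t \near 0^'+, x t = 1 * Num.sqrt ((N t + Qr t) / 2).
  have hc : cos t @[t --> 0^'+] --> (1 : R).
    by rewrite -cos0; apply: cvg_at_right_filter; exact: continuous_cos.
  have hc' : \forall t \near 0^'+, 0 < cos (t : R) by exact: (cvgr_gt 1).
  near=> t; rewrite mul1r.
  have st : 0 < sin t by near: t.
  have ct : 0 < cos t by near: t.
  have [h _] := root_re_sign a0 b0 c0 d0 st; apply: h.
  by rewrite addr_ge0 ?(ltW beta0)// mulr_ge0 ?(ltW ct)// mulr_ge0 ?sqr_ge0.
have u0 : 0 < 2 * a ^+ 2 + beta * cos 0 + 2 * a * (1 * Num.sqrt ((N 0 + Qr 0) / 2)).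
  rewrite cos0 mulr1 mul1r ltr_pwDl//; last by rewrite !mulr_ge0 ?sqrtr_ge0 ?(ltW a0).
  by rewrite addr_gt0// mulr_gt0// exprn_gt0.
have [] := edge_arg_cvg a0 b0 c0 d0 (at_right_proper_filter (0 : R)) cvg0 sF hx st0 yt0 (lt0r_neq0 u0).
by rewrite u0 => h1 h2; split=> //; eexists; exact: h2.
Unshelve. all: by end_near. Qed.

Lemma root_re_sign_change (th : R) : 0 <= th <= pi ->
  exists m, [/\ 0 <= m <= th, (forall t, t \in `]0, m[ -> 0 <= x t) &
    (forall t, t \in `]m, th[ -> x t <= 0)].
Proof.
move=> /andP[th0 thpi].
have sg t : 0 < t -> t < th -> 0 < sin t.
  by move=> h1 h2; apply: sin_gt0_pi; rewrite h1 (lt_le_trans h2).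
have b2 : 0 < b ^+ 2 by rewrite exprn_gt0.
have xp t : 0 < t -> t < th -> 0 <= beta + 2 * b ^+ 2 * cos t -> 0 <= x t.
  move=> h1 h2 h; have [hh _] := root_re_sign a0 b0 c0 d0 (sg _ h1 h2).
  by rewrite hh// sqrtr_ge0.
have xn t : 0 < t -> t < th -> beta + 2 * b ^+ 2 * cos t <= 0 -> x t <= 0.
  move=> h1 h2 h; have [_ hh] := root_re_sign a0 b0 c0 d0 (sg _ h1 h2).
  by rewrite hh// oppr_le0 sqrtr_ge0.
have [hb|hb] := leP (2 * b ^+ 2) beta.
  exists th; split; rewrite ?th0 ?lexx//; last first.
    by move=> t; rewrite in_itv/= => /andP[h1 h2]; have := lt_trans h1 h2; rewrite ltxx.
  move=> t; rewrite in_itv/= => /andP[h1 h2]; apply: xp => //.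
  have := cos_geN1 t; nra.
(* The cosine at which the radicand becomes real and negative, so that E is purely imaginary; cosine
   decreases on [0, pi], so there is one such angle. *)
pose q := - beta / (2 * b ^+ 2).
have q1 : -1 <= q <= 1.
  rewrite /q ler_pdivlMr ?mulr_gt0// ler_pdivrMr ?mulr_gt0//; apply/andP; split; have := beta0; lra.
have [h0 hq] := acos_def q1.
move: h0 => /andP[m0 mpi].
have qE t : beta + 2 * b ^+ 2 * cos t = 2 * b ^+ 2 * (cos t - q).
  by rewrite /q; field; rewrite gt_eqF.
exists (Num.min (acos q) th); split.
- by rewrite le_min m0 th0 ge_min lexx orbT.
- move=> t; rewrite in_itv/= lt_min => /andP[h1 /andP[h2 h3]]; apply: xp => //.
  rewrite qE; apply: mulr_ge0; first by rewrite mulr_ge0// ltW.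
  rewrite subr_ge0 -hq ltW// ltr_cos//.
    by rewrite in_itv/= !ltW// (lt_le_trans h3).
  by rewrite in_itv/= m0 mpi.
- move=> t; rewrite in_itv/= gt_min => /andP[/orP[h1|h1] h2]; last first.
    by have := lt_trans h1 h2; rewrite ltxx.
  have t0 : 0 < t by exact: le_lt_trans h1.
  apply: xn => //.
  rewrite qE; apply: mulr_ge0_le0; first by rewrite mulr_ge0// ltW.
  rewrite subr_le0 -hq ltW// ltr_cos//.
    by rewrite in_itv/= m0 mpi.
  by rewrite in_itv/= !ltW// (lt_le_trans h2).
Qed.

Let f_re (t : R) := a * x t / N t.
Let f_im (t : R) := - a * y t / N t.

Let good t (th : R) : th <= pi -> t \in `]0, th[ -> 0 < sin t /\ 0 < y t.
Proof.
move=> thpi; rewrite in_itv/= => /andP[h1 h2].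
have st : 0 < sin t by apply: sin_gt0_pi; rewrite h1 (lt_le_trans h2).
by split=> //; exact: sin_gt0_root_im.
Qed.

Let f_re_cont t : 0 < y t -> {for t, continuous f_re}.
Proof.
move=> yt; have [h _] := root_ratio_continuous yt.
have -> : f_re = (fun s => a * (x s / N s)) by apply/funext => s; rewrite /f_re mulrA.
by apply: cvgM => //; exact: cvg_cst.
Qed.

Let f_im_cont t : 0 < y t -> {for t, continuous f_im}.
Proof.
move=> yt; have [_ h] := root_ratio_continuous yt.
have -> : f_im = (fun s => - a * (y s / N s)) by apply/funext => s; rewrite /f_im mulrA.
by apply: cvgM => //; exact: cvg_cst.
Qed.

Let root_inv t : 0 < y t -> a%:C / E t = f_re t +i* f_im t.
Proof.
move=> yt; rewrite /f_re /f_im -root_normE//.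
have n0 : x t ^+ 2 + y t ^+ 2 != 0 by rewrite root_normE// gt_eqF// rad_norm_gt0.
by apply/eqP; rewrite eq_complex/=; apply/andP; split; apply/eqP; field.
Qed.

Let root_inv_conj t : 0 < y t -> a%:C / (E t)^* = f_re t +i* (- f_im t).
Proof.
move=> yt; rewrite /f_re /f_im -root_normE//.
have n0 : x t ^+ 2 + y t ^+ 2 != 0 by rewrite root_normE// gt_eqF// rad_norm_gt0.
by apply/eqP; rewrite eq_complex/= sqrrN; apply/andP; split; apply/eqP; field.
Qed.

Let has_cint_root (th L K K0 : R) : 0 < th -> th <= pi ->
  edge_arg t @[t --> th^'-] --> L -> edge_log t @[t --> th^'-] --> K ->
  edge_log t @[t --> 0^'+] --> K0 ->
  has_cint 0 th (fun t => a%:C / E t) (L +i* (K - K0)) /\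
  has_cint (2 * pi - th) (2 * pi : R) (fun t => a%:C / (E (2 * pi - t))^*) (L +i* - (K - K0)).
Proof.
move=> th0 thpi hL hK hK0.
have [hA _] := edge_arg_at0.
have [|m [/andP[m0 mth] xp xn]] := @root_re_sign_change th; first by rewrite ltW.
have D1 t : t \in `]0, th[ -> is_derive t 1 edge_arg (f_re t).
  by move=> /(good thpi)[st yt]; apply: is_derive_edge_arg => //; exact: ltW.
have D2 t : t \in `]0, th[ -> is_derive t 1 edge_log (f_im t).
  by move=> /(good thpi)[st yt]; apply: is_derive_edge_log => //; exact: ltW.
have C1 t : t \in `]0, th[ -> {for t, continuous f_re}.
  by move=> /(good thpi)[st yt]; exact: f_re_cont.
have C2 t : t \in `]0, th[ -> {for t, continuous f_im}.
  by move=> /(good thpi)[st yt]; exact: f_im_cont.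
have S1 t : t \in `]0, m[ -> 0 <= f_re t.
  by move=> /xp h; rewrite divr_ge0 ?rad_norm_ge0// mulr_ge0// ltW.
have S2 t : t \in `]m, th[ -> f_re t <= 0.
  move=> /xn h; rewrite mulr_le0_ge0 ?invr_ge0 ?rad_norm_ge0//.
  by rewrite mulr_ge0_le0// ltW.
(* The imaginary part has no positive stretch: its change of sign is placed at the left end 0. *)
have S3 t : t \in `]0, 0[ -> 0 <= f_im t.
  by rewrite in_itv/= => /andP[h1 h2]; have := lt_trans h1 h2; rewrite ltxx.
have S4 t : t \in `]0, th[ -> f_im t <= 0.
  move=> _; rewrite /f_im mulNr mulNr oppr_le0 divr_ge0 ?rad_norm_ge0//.
  by rewrite mulr_ge0 ?(ltW a0)// sqrtr_ge0.
have th0' := ltW th0.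
split.
  have i1 := has_int_ftc_ge0_le0 m0 mth th0 D1 C1 S1 S2 hA hL.
  have i2 := has_int_ftc_ge0_le0 (lexx 0) th0' th0 D2 C2 S3 S4 hK0 hK.
  rewrite subr0 in i1.
  split; [apply: has_int_eq i1|apply: has_int_eq i2] => t tI;
    by have [_ yt] := good thpi tI; rewrite (root_inv yt).
have i1 := has_int_ftc_reflect (2 * pi) m0 mth th0 D1 C1 S1 S2 hA hL.
have i2 := has_int_ftc_reflect (2 * pi) (lexx 0) th0' th0 D2 C2 S3 S4 hK0 hK.
have {}i2 := has_intZ (-1) i2.
rewrite !subr0 ?mulN1r in i1 i2.
have tI' t : t \in `](2 * pi - th), (2 * pi)[ -> 2 * pi - t \in `]0, th[.
  by rewrite !in_itv/=; lra.
split; [apply: has_int_eq i1|apply: has_int_eq i2] => t /tI' tI;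
  by have [_ yt] := good thpi tI; rewrite (root_inv_conj yt)//= mulN1r.
Qed.

(** The circle splits at th, pi and 2 pi - th; the two middle pieces vanish and the outer two are
    conjugate. The value of the inner integral at the cuts is irrelevant, and th = 0 or th = pi
    leaves some pieces empty. *)
Theorem edge_prob_arg (th L : R) : 0 <= th <= pi ->
  (forall t, t \in `]0, th[ -> 0 < crit (cos t)) ->
  (forall t, t \in `]th, pi[ -> crit (cos t) < 0) ->
  (0 < th -> edge_arg t @[t --> th^'-] --> L /\
    exists K : R, edge_log t @[t --> th^'-] --> K) ->
  (th = 0 -> L = 0) ->
  edge_prob a b c d = (L / pi)%:C.
Proof.
move=> /andP[th0 thpi] cpos cneg hlim hL.
pose g t := cint (edge_integrand a b c d t).
have [W [h1 h4]] : exists W : R,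
    has_cint 0 th g ((2 * pi / a)%:C * (L +i* W)) /\
    has_cint (2 * pi - th) (2 * pi : R) g ((2 * pi / a)%:C * (L +i* - W)).
  have [th00|thn0] := eqVneq th 0.
    exists 0; rewrite th00 subr0 (hL th00) oppr0 (_ : 0 +i* 0 = 0)// mulr0.
    by split; split; exact: has_int_triv.
  have thp : 0 < th by rewrite lt_neqAle eq_sym thn0.
  have [lA [K lK]] := hlim thp; have [_ [K0 lK0]] := edge_arg_at0.
  have [i1 i2] := has_cint_root thp thpi lA lK lK0.
  have aC : a%:C != 0 :> R[i] by rewrite eq_complex/= negb_and gt_eqF.
  have cE : (2 * pi / a)%:C = (2 * pi)%:C / a%:C :> R[i] by rewrite rmorphM fmorphV.
  exists (K - K0); split.
    apply: has_cint_eq (has_cintZ (2 * pi / a)%:C i1) => t tI.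
    have [st yt] := good thpi tI.
    have [e _] := cint_edge_out a0 b0 c0 d0 st (cpos t tI).
    by rewrite /g e cE mulrA divfK.
  apply: has_cint_eq (has_cintZ (2 * pi / a)%:C i2) => t tI.
  have tI' : 2 * pi - t \in `]0, th[ by move: tI; rewrite !in_itv/=; lra.
  have [st yt] := good thpi tI'.
  have [_ e] := cint_edge_out a0 b0 c0 d0 st (cpos _ tI').
  by move: e; rewrite subKr /g => ->; rewrite cE mulrA divfK.
have h2 : has_cint th pi g 0.
  apply: has_cint_eq (has_cint0 th pi) => t tI.
  have st : 0 < sin t by move: tI; rewrite in_itv/= => tI; apply: sin_gt0_pi; lra.
  by have [e _] := cint_edge_in a0 b0 c0 d0 st (cneg t tI); rewrite /g e.
have h3 : has_cint pi (2 * pi - th) g 0.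
  apply: has_cint_eq (has_cint0 pi (2 * pi - th)) => t tI.
  have tI' : 2 * pi - t \in `]th, pi[ by move: tI; rewrite !in_itv/=; lra.
  have st : 0 < sin (2 * pi - t) by move: tI'; rewrite in_itv/= => tI'; apply: sin_gt0_pi; lra.
  have [_ e] := cint_edge_in a0 b0 c0 d0 st (cneg _ tI').
  by move: e; rewrite subKr /g => ->.
have p1 : pi <= 2 * pi - th by lra.
have p2 : 2 * pi - th <= 2 * pi by lra.
have h34 := has_cint_cat p1 p2 h3 h4.
have p3 : pi <= 2 * pi :> R by lra.
have h234 := has_cint_cat thpi p3 h2 h34.
have p4 : th <= 2 * pi by lra.
have := has_cint_cint (has_cint_cat th0 p4 h1 h234).
rewrite /edge_prob -/g => ->.
have pin : pi != 0 :> R by rewrite gt_eqF.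
have an : a != 0 by rewrite gt_eqF.
rewrite !add0r -mulrDr.
(* Conjugate contributions: the logarithmic parts cancel and the angle is doubled. *)
have -> : (L +i* W) + (L +i* - W) = (2 * L)%:C.
  by apply/eqP; rewrite eq_complex/=; apply/andP; split; apply/eqP; ring.
rewrite -!rmorphM/=; congr (_%:C).
have h (p : R) : p != 0 -> a / (4 * p ^+ 2) * (2 * p / a * (2 * L)) = L / p.
  by move=> pn; field; rewrite an pn.
exact: h.
Qed.

End Evaluation.

(** * Values at the endpoint of the arc *)

Section Degenerate.
Context {R : realType}.
Variables (a b c d : R).
Hypotheses (a0 : 0 < a) (b0 : 0 < b) (c0 : 0 < c) (d0 : 0 < d).

Let le_sqr (x y : R) : 0 <= x -> x <= y -> x ^+ 2 <= y ^+ 2.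
Proof. by move=> x0 xy; rewrite ler_sqr ?nnegrE// (le_trans x0). Qed.

Let slope : 0 < (a * c + b * d) * (a * d + b * c).
Proof. by rewrite mulr_gt0// addr_gt0// mulr_gt0. Qed.

(** Expansion at the cosine of pi: if |a - b| >= c + d the value there is nonnegative, so [crit] is
    positive on the whole open half circle. [crit1] expands at the cosine of 0, where a + b <= |c -
    d| makes the value nonpositive and the arc empty. *)
Lemma critN1 (X : R) : crit a b c d X =
  (c - d) ^+ 2 * ((a - b) ^+ 2 - (c + d) ^+ 2) +
  2 * ((a * c + b * d) * (a * d + b * c)) * (X + 1).
Proof. by rewrite /crit; ring. Qed.

Lemma crit1 (X : R) : crit a b c d X =
  (c + d) ^+ 2 * ((a + b) ^+ 2 - (c - d) ^+ 2) -
  2 * ((a * c + b * d) * (a * d + b * c)) * (1 - X).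
Proof. by rewrite /crit; ring. Qed.

Lemma cos_oo (t : R) : 0 < t -> t < pi -> -1 < cos t < 1.
Proof.
move=> t0 tpi; have st : 0 < sin t by apply: sin_gt0_pi; rewrite t0.
have := cos2Dsin2 t; have : 0 < sin t ^+ 2 by rewrite exprn_gt0.
by move=> h1 h2; apply/andP; split; nra.
Qed.

Lemma crit_gt0_all : (c + d) ^+ 2 <= (a - b) ^+ 2 ->
  forall t, t \in `]0, pi[ -> 0 < crit a b c d (cos t).
Proof.
move=> h t; rewrite in_itv/= => /andP[t0 tpi].
have /andP[h1 _] := cos_oo t0 tpi.
rewrite critN1 ltr_wpDl//; first by rewrite mulr_ge0 ?sqr_ge0// subr_ge0.
by apply: mulr_gt0; [rewrite mulr_gt0|lra].
Qed.

Let cvg_pi : (fun t : R => t) @ pi^'- --> (pi : R).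
Proof. by apply: cvg_at_left_filter; exact: cvg_id. Qed.

Let sin_pi : \forall t \near (pi : R)^'-, 0 < sin t.
Proof.
near=> t; apply: sin_gt0_pi; apply/andP; split; near: t.
  exact: nbhs_left_gt (pi_gt0 R).
exact: nbhs_left_lt.
Unshelve. all: by end_near. Qed.

(** At pi the radicand is the real number (a - b)^2 - 4 c d, which is at least (c - d)^2. *)
Let root_im_pi : (c + d) ^+ 2 <= (a - b) ^+ 2 -> root_im a b c d pi = 0.
Proof.
move=> h; apply: root_im_real; first by rewrite /rad_im sinpi; ring.
rewrite /rad_re /root_mid sinpi cospi.
have := sqr_ge0 (c - d); nra.
Qed.

Notation S := (Num.sqrt ((rad_norm a b c d pi + rad_re a b c d pi) / 2)).

Let pi0 : 0 < pi :> R := pi_gt0 R.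

Theorem edge_prob_dominant : b + c + d <= a -> edge_prob a b c d = 1.
Proof.
move=> h; move: (a0) (b0) (c0) (d0) => a1 b1 c1 d1.
have hab : (c + d) ^+ 2 <= (a - b) ^+ 2.
  by apply: le_sqr; lra.
have -> : 1 = (pi / pi : R)%:C by rewrite divff ?gt_eqF.
apply: (edge_prob_arg a0 b0 c0 d0 (th := pi)).
- by rewrite lexx ltW.
- exact: crit_gt0_all.
- by move=> t; rewrite in_itv/= => /andP[h1 h2]; have := lt_trans h1 h2; rewrite ltxx.
- move=> _.
  have hx : \forall t \near pi^'-, root_re a b c d t =
      1 * Num.sqrt ((rad_norm a b c d t + rad_re a b c d t) / 2).
    (* Here [root_mid + 2 * b ^+ 2 * cos t] is at least 2 b (a - b) + 4 c d > 0, so the real part of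
       the root is nonnegative. *)
    near=> t; rewrite mul1r; have st : 0 < sin t by near: t.
    have [e _] := root_re_sign a0 b0 c0 d0 st; apply: e.
    have := cos_geN1 t; have : 0 < c * d by rewrite mulr_gt0.
    have : 0 < b * (a - b) by rewrite mulr_gt0//; lra.
    rewrite /root_mid; nra.
  have u0 : 0 < 2 * a ^+ 2 + root_mid a b c d * cos pi + 2 * a * (1 * S).
    rewrite ltr_pwDl//; last by rewrite mul1r !mulr_ge0 ?sqrtr_ge0// ltW.
    rewrite cospi /root_mid.
    have := sqr_ge0 (c - d); have : 0 < c * d by rewrite mulr_gt0.
    nra.
  have [] := edge_arg_cvg a0 b0 c0 d0 (at_left_proper_filter (pi : R)) cvg_pi sin_pi hx (sinpi R) (root_im_pi hab) (lt0r_neq0 u0).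
  by rewrite u0 => h1 h2; split=> //; eexists; exact: h2.
- by move=> e; move: pi0; rewrite e ltxx.
Unshelve. all: by end_near. Qed.

Theorem edge_prob_opposite : a + c + d <= b -> edge_prob a b c d = 0.
Proof.
move=> h; move: (a0) (b0) (c0) (d0) => a1 b1 c1 d1.
have hab : (c + d) ^+ 2 <= (a - b) ^+ 2.
  by rewrite -(sqrrN (a - b)); apply: le_sqr; lra.
have cd : 0 < c * d by rewrite mulr_gt0.
have hb : root_mid a b c d < 2 * b ^+ 2.
  have := sqr_ge0 (c - d); rewrite /root_mid; nra.
have -> : 0 = (0 / pi : R)%:C by rewrite mul0r.
apply: (edge_prob_arg a0 b0 c0 d0 (th := pi)).
- by rewrite lexx ltW.
- exact: crit_gt0_all.
- by move=> t; rewrite in_itv/= => /andP[h1 h2]; have := lt_trans h1 h2; rewrite ltxx.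
- move=> _.
  have hc : cos t @[t --> (pi : R)^'-] --> (-1 : R).
    by rewrite -cospi; apply: cvg_at_left_filter; exact: continuous_cos.
  have b2 : 0 < 2 * b ^+ 2 by rewrite mulr_gt0// exprn_gt0.
  (* Past this bound on the cosine the real part of the root has already changed sign; the bound
     exceeds -1 by [hb]. *)
  have hq : \forall t \near (pi : R)^'-, cos t < - root_mid a b c d / (2 * b ^+ 2).
    by apply: (cvgr_lt (-1)) => //; rewrite ltr_pdivlMr//; lra.
  have hx : \forall t \near pi^'-, root_re a b c d t =
      -1 * Num.sqrt ((rad_norm a b c d t + rad_re a b c d t) / 2).
    near=> t; rewrite mulN1r; have st : 0 < sin t by near: t.
    have [_ e] := root_re_sign a0 b0 c0 d0 st; apply: e.
    have : cos t < - root_mid a b c d / (2 * b ^+ 2) by near: t.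
    by rewrite ltr_pdivlMr//; lra.
  (* The negative limit gives the argument pi, so [edge_arg] tends to pi - pi = 0. *)
  have u0 : 2 * a ^+ 2 + root_mid a b c d * cos pi + 2 * a * (-1 * S) < 0.
    have : 0 <= a * S by rewrite mulr_ge0 ?sqrtr_ge0// ltW.
    set s := S; rewrite cospi /root_mid => aS.
    have : 0 < a * (b - a) by rewrite mulr_gt0//; lra.
    move: aS; nra.
  have [] := edge_arg_cvg a0 b0 c0 d0 (at_left_proper_filter (pi : R)) cvg_pi sin_pi hx (sinpi R) (root_im_pi hab) (ltr0_neq0 u0).
  by rewrite ltNge (ltW u0) subrr => h1 h2; split=> //; eexists; exact: h2.
- by [].
Unshelve. all: by end_near. Qed.

Theorem edge_prob_adjacent : a + b + d <= c \/ a + b + c <= d ->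
  edge_prob a b c d = 0.
Proof.
move=> h; move: (a0) (b0) (c0) (d0) => a1 b1 c1 d1.
have hab : (a + b) ^+ 2 <= (c - d) ^+ 2.
  case: h => h; first by apply: le_sqr; lra.
  by rewrite -(sqrrN (c - d)); apply: le_sqr; lra.
have -> : 0 = (0 / pi : R)%:C by rewrite mul0r.
apply: (edge_prob_arg a0 b0 c0 d0 (th := 0)) => //.
- by rewrite lexx ltW.
- by move=> t; rewrite in_itv/= => /andP[h1 h2]; have := lt_trans h1 h2; rewrite ltxx.
- move=> t; rewrite in_itv/= => /andP[t0 tpi].
  have /andP[_ h1] := cos_oo t0 tpi.
  rewrite crit1 subr_lt0.
  apply: (@le_lt_trans _ _ 0).
    by rewrite mulr_ge0_le0 ?sqr_ge0// subr_le0.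
  by apply: mulr_gt0; [rewrite mulr_gt0|lra].
- by rewrite ltxx.
Qed.

End Degenerate.

(** * Sides expressed by inscribed angles *)

Section HalfAngles.
Context {R : realType}.

Let cos_sq (t : R) : cos t ^+ 2 = 1 - sin t ^+ 2.
Proof. by rewrite -(cos2Dsin2 t) addrK. Qed.

Section Identities.
Variables (h A B C D : R).
Hypothesis sumE : A + B + C + D = pi.
Let a := h * sin A. Let b := h * sin B. Let c := h * sin C. Let d := h * sin D.
Let th := pi - (C - D).

(** Eliminating D, and writing [th] as 2 pi - (A + B + 2 C), leaves polynomial identities in the
    sines and cosines of three free angles, decided modulo cos^2 = 1 - sin^2. *)
Let sinDE : sin D = sin (A + B + C).
Proof.
have -> : D = - (A + B + C) + pi by rewrite -sumE; ring.
by rewrite sinDpi sinN opprK.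
Qed.

Let thE : th = - (A + B + C + C) + pi *+ 2.
Proof. by rewrite /th -mulr_natl -sumE; ring. Qed.

Let cos_th : cos th = cos (A + B + C + C).
Proof. by rewrite thE cosD2pi cosN. Qed.

Let sin_th : sin th = - sin (A + B + C + C).
Proof. by rewrite thE sinD2pi sinN. Qed.

Let cos_thA : cos (th - A) = cos (A + B + C + C + A).
Proof.
have -> : th - A = - (A + B + C + C + A) + pi *+ 2 by rewrite thE; ring.
by rewrite cosD2pi cosN.
Qed.

Let sin_thA : sin (th - A) = - sin (A + B + C + C + A).
Proof.
have -> : th - A = - (A + B + C + C + A) + pi *+ 2 by rewrite thE; ring.
by rewrite sinD2pi sinN.
Qed.

(* The endpoint value of the square root is E = -(c e^{-i(A+C)} + d e^{-i(B+C)}). *)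
Definition end_re := - (c * cos (A + C) + d * cos (B + C)).
Definition end_im := c * sin (A + C) + d * sin (B + C).

Lemma end_sqr_re : end_re ^+ 2 - end_im ^+ 2 = rad_re a b c d th.
Proof.
rewrite /end_re /end_im /rad_re /root_mid /a /b /c /d cos_th sin_th sinDE !(sinD, cosD).
by ring: (cos_sq A) (cos_sq B) (cos_sq C).
Qed.

Lemma end_sqr_im : 2 * end_re * end_im = rad_im a b c d th.
Proof.
rewrite /end_re /end_im /rad_im /root_mid /a /b /c /d cos_th sin_th sinDE !(sinD, cosD).
by ring: (cos_sq A) (cos_sq B) (cos_sq C).
Qed.

(** States that arg_re + i arg_im at [th] is a real multiple of exp (i (th - A)); the multiple is
    positive once [arg_im] and [sin (th - A)] are. *)
Lemma end_arg :
  (2 * a ^+ 2 + root_mid a b c d * cos th + 2 * a * end_re) * sin (th - A) =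
  (root_mid a b c d * sin th + 2 * a * end_im) * cos (th - A).
Proof.
rewrite /end_re /end_im /root_mid /a /b /c /d cos_thA sin_thA cos_th sin_th sinDE !(sinD, cosD).
by ring: (cos_sq A) (cos_sq B) (cos_sq C).
Qed.

Lemma end_crit : crit a b c d (cos th) = 0.
Proof.
rewrite /crit /a /b /c /d cos_th sinDE !(sinD, cosD).
by ring: (cos_sq A) (cos_sq B) (cos_sq C).
Qed.

(** Ptolemy's theorem: with sides in the order a, c, b, d the diagonals are h sin (A + C) and h sin
    (B + C). The next two lemmas are the same theorem after rearranging the sides on the circle. *)
Lemma ptolemy_ab_cd : a * b + c * d = h ^+ 2 * (sin (A + C) * sin (B + C)).
Proof.
rewrite /a /b /c /d sinDE !(sinD, cosD).
by ring: (cos_sq A) (cos_sq B) (cos_sq C).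
Qed.

Lemma ptolemy_ac_bd : a * c + b * d = h ^+ 2 * (sin (A + B) * sin (B + C)).
Proof.
rewrite /a /b /c /d sinDE !(sinD, cosD).
by ring: (cos_sq A) (cos_sq B) (cos_sq C).
Qed.

Lemma ptolemy_ad_bc : a * d + b * c = h ^+ 2 * (sin (A + B) * sin (A + C)).
Proof.
rewrite /a /b /c /d sinDE !(sinD, cosD).
by ring: (cos_sq A) (cos_sq B) (cos_sq C).
Qed.

(** With a and b adjacent, the diagonal h sin (A + B) closes a triangle with a, b and one with c, d.
    Equating the two cosine laws, with cos (C + D) = - cos (A + B), gives this relation. *)
Lemma diagonal_law : a ^+ 2 + b ^+ 2 - c ^+ 2 - d ^+ 2 =
  - (2 * (h ^+ 2 * (sin (A + C) * sin (B + C))) * cos (A + B)).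
Proof.
rewrite /a /b /c /d sinDE !(sinD, cosD).
by ring: (cos_sq A) (cos_sq B) (cos_sq C).
Qed.

End Identities.

Lemma end_values (h A B C D : R) : A + B + C + D = pi ->
  let a := h * sin A in let b := h * sin B in
  let c := h * sin C in let d := h * sin D in
  0 < end_im h A B C D ->
  root_im a b c d (pi - (C - D)) = end_im h A B C D /\
  root_re a b c d (pi - (C - D)) = end_re h A B C D.
Proof.
move=> sumE a b c d e0.
have hr := end_sqr_re h sumE; have hi := end_sqr_im h sumE.
rewrite -/a -/b -/c -/d in hr hi.
have hN : rad_norm a b c d (pi - (C - D)) = end_re h A B C D ^+ 2 + end_im h A B C D ^+ 2.
  rewrite /rad_norm -hr -hi.
  have -> : forall p q : R, (p ^+ 2 - q ^+ 2) ^+ 2 + (2 * p * q) ^+ 2 = (p ^+ 2 + q ^+ 2) ^+ 2.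
    by move=> p q; ring.
  by rewrite sqrtr_sqr ger0_norm// addr_ge0 ?sqr_ge0.
have hy : root_im a b c d (pi - (C - D)) = end_im h A B C D.
  rewrite /root_im hN -hr.
  have -> : forall p q : R, (p ^+ 2 + q ^+ 2 - (p ^+ 2 - q ^+ 2)) / 2 = q ^+ 2.
    by move=> p q; field.
  by rewrite sqrtr_sqr gtr0_norm.
split=> //; rewrite /root_re hy -hi.
by field; rewrite gt_eqF.
Qed.

Lemma tan_subr_pihalf (t : R) : tan (pi / 2 - t) = cos t / sin t.
Proof.
have -> : pi / 2 - t = - t + pi / 2 by rewrite addrC.
by rewrite /tan sinDpihalf cosDpihalf cosN sinN opprK.
Qed.

Let edge_arg_ordered (h A B C D : R) : 0 < h ->
  0 < A -> 0 < B -> 0 < C -> 0 < D -> A + B + C + D = pi -> D <= C ->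
  let a := h * sin A in let b := h * sin B in
  let c := h * sin C in let d := h * sin D in
  exists th, [/\ 0 < th <= pi, crit a b c d (cos th) = 0,
    0 < root_im a b c d th & edge_arg a b c d th = A].
Proof.
move=> h0 A0 B0 C0 D0 sumE DC a b c d.
have a0 : 0 < a by rewrite mulr_gt0// sin_gt0_pi//; lra.
have b0 : 0 < b by rewrite mulr_gt0// sin_gt0_pi//; lra.
have c0 : 0 < c by rewrite mulr_gt0// sin_gt0_pi//; lra.
have d0 : 0 < d by rewrite mulr_gt0// sin_gt0_pi//; lra.
have e0 : 0 < end_im h A B C D.
  by rewrite addr_gt0// !mulr_gt0// ?sin_gt0_pi//; lra.
have [hy hx] := end_values sumE e0; rewrite -/a -/b -/c -/d in hy hx.
pose th := pi - (C - D).
have thb : 0 < th <= pi by rewrite /th; lra.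
(* th - A equals B + 2 D, which D <= C keeps below pi; hence the arctangent below is taken in its
   principal range. *)
have psi : 0 < th - A < pi by rewrite /th; lra.
have spsi : 0 < sin (th - A) by exact: sin_gt0_pi.
exists th; split=> //; first exact: end_crit.
  by rewrite hy.
have st : 0 <= sin th.
  move: thb => /andP[h1]; rewrite le_eqVlt => /orP[/eqP ->|h2]; first by rewrite sinpi.
  by rewrite ltW// sin_gt0_pi// h1.
have yt : 0 < root_im a b c d th by rewrite hy.
have vt := arg_im_gt0 a0 b0 c0 d0 st yt.
have := end_arg h sumE; rewrite -/a -/b -/c -/d -/th -hx -hy -/th -/(arg_re _ _ _ _ _) -/(arg_im _ _ _ _ _) => e.
rewrite /edge_arg.
have -> : arg_re a b c d th / arg_im a b c d th = cos (th - A) / sin (th - A).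
  have vn : arg_im a b c d th != 0 by rewrite gt_eqF.
  have sn : sin (th - A) != 0 by rewrite gt_eqF.
  by apply/eqP; rewrite eqr_div//; apply/eqP; rewrite e mulrC.
rewrite -tan_subr_pihalf tanK; last by rewrite in_itv/=; lra.
by ring.
Qed.

Lemma root_midC (a b c d : R) : root_mid a b d c = root_mid a b c d.
Proof. by rewrite /root_mid; ring. Qed.

Theorem edge_prob_half_angles (h A B C D : R) : 0 < h ->
  0 < A -> 0 < B -> 0 < C -> 0 < D -> A + B + C + D = pi ->
  edge_prob (h * sin A) (h * sin B) (h * sin C) (h * sin D) = (A / pi)%:C.
Proof.
move=> h0 A0 B0 C0 D0 sumE.
set a := h * sin A; set b := h * sin B; set c := h * sin C; set d := h * sin D.
have a0 : 0 < a by rewrite mulr_gt0// sin_gt0_pi//; lra.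
have b0 : 0 < b by rewrite mulr_gt0// sin_gt0_pi//; lra.
have c0 : 0 < c by rewrite mulr_gt0// sin_gt0_pi//; lra.
have d0 : 0 < d by rewrite mulr_gt0// sin_gt0_pi//; lra.
have [th [/andP[th0 thpi] hc hy hA]] : exists th, [/\ 0 < th <= pi,
    crit a b c d (cos th) = 0, 0 < root_im a b c d th & edge_arg a b c d th = A].
  (* The order of C and D only served to have th <= pi; [crit] and [edge_arg] are symmetric in c and
     d. *)
  have [DC|CD] := leP D C; first exact: edge_arg_ordered.
  have sumE' : A + B + D + C = pi by rewrite -sumE; ring.
  have [th [e1 e2 e3 e4]] := edge_arg_ordered h0 A0 B0 D0 C0 sumE' (ltW CD).
  exists th; split=> //.
  - by rewrite -e2 -/a -/b -/c -/d /crit; ring.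
  - by move: e3; rewrite -/a -/b -/c -/d /root_im /rad_norm /rad_re /rad_im root_midC.
  - by move: e4; rewrite -/a -/b -/c -/d /edge_arg /arg_re /arg_im /root_re /root_im
      /rad_norm /rad_re /rad_im root_midC.
have slope : 0 < (a * c + b * d) * (a * d + b * c).
  by rewrite mulr_gt0// addr_gt0// mulr_gt0.
(* An affine function is determined by its slope and its zero. *)
have critE X : crit a b c d X = 2 * ((a * c + b * d) * (a * d + b * c)) * (X - cos th).
  transitivity (crit a b c d X - crit a b c d (cos th)); first by rewrite hc subr0.
  by rewrite /crit; ring.
have st : 0 <= sin th.
  move: thpi; rewrite le_eqVlt => /orP[/eqP ->|h2]; first by rewrite sinpi.
  by rewrite ltW// sin_gt0_pi// th0.
apply: (edge_prob_arg a0 b0 c0 d0 (th := th)).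
- by rewrite thpi ltW.
- move=> t; rewrite in_itv/= => /andP[t0 tth].
  rewrite critE; apply: mulr_gt0; first by rewrite mulr_gt0.
  by rewrite subr_gt0 ltr_cos//; rewrite in_itv/=; lra.
- move=> t; rewrite in_itv/= => /andP[tth tpi].
  rewrite critE pmulr_rlt0; last by rewrite mulr_gt0.
  by rewrite subr_lt0 ltr_cos//; rewrite in_itv/=; lra.
- move=> _; split.
    rewrite -hA; apply: cvg_at_left_filter.
    exact: is_derive1_continuous (is_derive_edge_arg a0 b0 c0 d0 st hy).
  exists (edge_log a b c d th); apply: cvg_at_left_filter.
  exact: is_derive1_continuous (is_derive_edge_log a0 b0 c0 d0 st hy).
- by move=> e; move: th0; rewrite e ltxx.
Qed.

(** The quartic product is 4 (a b + c d)^2 - (a^2 + b^2 - c^2 - d^2)^2, a square by the diagonal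
    law. The three Ptolemy products multiply to another square, and the quotient of the roots is a /
    h. *)
Theorem arcsin_arg_half_angles (h A B C D : R) : 0 < h ->
  0 < A -> 0 < B -> 0 < C -> 0 < D -> A + B + C + D = pi ->
  arcsin_arg (h * sin A) (h * sin B) (h * sin C) (h * sin D) = sin A.
Proof.
move=> h0 A0 B0 C0 D0 sumE; rewrite /arcsin_arg.
have p1 := ptolemy_ab_cd h sumE; have p2 := ptolemy_ac_bd h sumE.
have p3 := ptolemy_ad_bc h sumE; have dl := diagonal_law h sumE.
move: p1 p2 p3 dl.
set a := h * sin A; set b := h * sin B; set c := h * sin C; set d := h * sin D.
set S1 := sin (A + B); set S2 := sin (A + C); set S3 := sin (B + C) => p1 p2 p3 dl.
have S10 : 0 < S1 by apply: sin_gt0_pi; lra.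
have S20 : 0 < S2 by apply: sin_gt0_pi; lra.
have S30 : 0 < S3 by apply: sin_gt0_pi; lra.
pose W := S1 * S2 * S3.
have W0 : 0 < W by rewrite !mulr_gt0.
have -> : (a + b + c - d) * (a + b - c + d) * (a - b + c + d) * (- a + b + c + d) =
    (2 * h ^+ 2 * W) ^+ 2.
  transitivity (4 * (a * b + c * d) ^+ 2 - (a ^+ 2 + b ^+ 2 - c ^+ 2 - d ^+ 2) ^+ 2).
    by ring.
  by rewrite dl p1 /W; have := cos_sq (A + B); rewrite -/S1 => cs; ring: cs.
have -> : (a * b + c * d) * (a * c + b * d) * (a * d + b * c) = (h ^+ 3 * W) ^+ 2.
  by rewrite p1 p2 p3 /W; ring.
rewrite !sqrtr_sqr !gtr0_norm ?mulr_gt0 ?exprn_gt0//.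
by rewrite /a; field; rewrite !gt_eqF.
Qed.

Lemma arcsin_branch_sin (A : R) : 0 < A -> A < pi ->
  arcsin_branch (2 * A) (sin A) = A.
Proof.
move=> A0 Api; rewrite /arcsin_branch; case: ifPn => [h|].
  by rewrite sinK// in_itv/=; lra.
rewrite -ltNge => h.
have -> : sin A = sin (pi - A) by rewrite addrC sinDpi sinN opprK.
by rewrite sinK; [ring|rewrite in_itv/=; lra].
Qed.

End HalfAngles.

(** * Cyclic quadrilaterals *)

Section CircleGeometry.
Context {R : realType}.
Implicit Types (O P Q X : R * R) (r s t p q x h alpha : R).

Lemma cos_eq1 x : - (2 * pi) < x < 2 * pi -> cos x = 1 -> x = 0.
Proof.
move=> xb cx.
have s0 : sin (x / 2) = 0.
  have e : x = x / 2 + x / 2 by field.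
  have := cos2Dsin2 (x / 2); move: cx; rewrite {1}e cosD => h1 h2.
  by apply/eqP; rewrite -sqrf_eq0; apply/eqP; lra.
have [xn|xp|//] := ltgtP x 0.
  have : 0 < sin (- (x / 2)) by apply: sin_gt0_pi; lra.
  by rewrite sinN s0 oppr0 ltxx.
have : 0 < sin (x / 2) by apply: sin_gt0_pi; lra.
by rewrite s0 ltxx.
Qed.

Lemma circ_eq O r s t : 0 < r -> circ O r s = circ O r t ->
  cos s = cos t /\ sin s = sin t.
Proof.
move=> r0 [/addrI e1 /addrI e2].
have rn : r != 0 by rewrite gt_eqF.
by split; [exact: (mulfI rn e1)|exact: (mulfI rn e2)].
Qed.

Lemma circ_shift O r s t x : cos s = cos t -> sin s = sin t ->
  circ O r (s + x) = circ O r (t + x).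
Proof. by move=> e1 e2; rewrite /circ !cosD !sinD e1 e2. Qed.

Lemma circD2pi O r t : circ O r (t + 2 * pi) = circ O r t.
Proof. by rewrite /circ mulr_natl cosD2pi sinD2pi. Qed.

Lemma cos_diff s t u v : cos s = cos t -> sin s = sin t ->
  cos u = cos v -> sin u = sin v -> cos ((u - s) - (v - t)) = 1.
Proof.
move=> e1 e2 e3 e4.
have c1 : cos (u - s) = cos (v - t) by rewrite !cosB e1 e2 e3 e4.
have c2 : sin (u - s) = sin (v - t) by rewrite !sinB e1 e2 e3 e4.
by rewrite cosB c1 c2 -!expr2 cos2Dsin2.
Qed.

Lemma arc_angle O r p q x s alpha : 0 < r ->
  p < q -> q < x -> x < p + 2 * pi -> 0 < alpha < 2 * pi ->
  (circ O r p = circ O r s /\ circ O r q = circ O r (s + alpha)) \/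
  (circ O r q = circ O r s /\ circ O r p = circ O r (s + alpha)) ->
  ~ Defs.arc O r s alpha (circ O r x) -> alpha = q - p.
Proof.
move=> r0 pq qx xp ab [] [/(circ_eq r0)[e1 e2] /(circ_eq r0)[e3 e4]] na.
  have := cos_diff e1 e2 e3 e4.
  rewrite [s + alpha - s]addrAC subrr add0r => h.
  have bd : - (2 * pi) < q - p - alpha < 2 * pi by lra.
  by have := cos_eq1 bd h; lra.
exfalso; apply: na.
have := cos_diff e1 e2 e3 e4.
rewrite [s + alpha - s]addrAC subrr add0r => h.
have h2 : cos (p + 2 * pi - q - alpha) = 1.
  have -> : p + 2 * pi - q - alpha = (p - q - alpha) + pi *+ 2.
    by rewrite -mulr_natl; ring.
  by rewrite cosD2pi.
have aE : alpha = p + 2 * pi - q.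
  have bd : - (2 * pi) < p + 2 * pi - q - alpha < 2 * pi by lra.
  by have := cos_eq1 bd h2; lra.
(* Here s is the direction of q, and x lies x - q further along this arc. *)
exists (s + (x - q)); first by rewrite /= in_itv/=; lra.
by rewrite -(circ_shift O r (x - q) e1 e2) addrC subrK.
Qed.

Lemma dist2_circ O r s t : 0 < r -> 0 <= t - s <= 2 * pi ->
  dist2 (circ O r s) (circ O r t) = 2 * r * sin ((t - s) / 2).
Proof.
move=> r0 ts; rewrite /dist2 /circ/=.
have s0 : 0 <= sin ((t - s) / 2).
  have h : 0 <= (t - s) / 2 <= pi by lra.
  move: h => /andP[]; rewrite le_eqVlt => /orP[/eqP <- _|h1]; first by rewrite sin0.
  rewrite le_eqVlt => /orP[/eqP ->|h2]; first by rewrite sinpi.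
  by rewrite ltW// sin_gt0_pi// h1.
have e : (O.1 + r * cos s - (O.1 + r * cos t)) ^+ 2 +
    (O.2 + r * sin s - (O.2 + r * sin t)) ^+ 2 = (2 * r * sin ((t - s) / 2)) ^+ 2.
  pose u := (t + s) / 2; pose v := (t - s) / 2.
  have -> : t = u + v by rewrite /u /v; field.
  have -> : s = u - v by rewrite /u /v; field.
  have -> : (u + v - (u - v)) / 2 = v by field.
  rewrite cosB sinB cosD sinD.
  have cu : cos u ^+ 2 = 1 - sin u ^+ 2 by rewrite -(cos2Dsin2 u) addrK.
  by ring: cu.
by rewrite e sqrtr_sqr ger0_norm// !mulr_ge0// ltW.
Qed.

Lemma dist2C P Q : dist2 P Q = dist2 Q P.
Proof. by rewrite /dist2; congr Num.sqrt; ring. Qed.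

(** The angles are half the central angles of the four arcs, which together make a full turn; a
    chord is the diameter times the sine of its half-angle. *)
Lemma quad_half_angles a b c d O r (A B C D : R * R) alpha :
  quad_with_angle a b c d O r A B C D alpha ->
  exists hA hB hC hD : R,
    [/\ [/\ 0 < r, 0 < hA, 0 < hB, 0 < hC & 0 < hD],
      hA + hB + hC + hD = pi, alpha = 2 * hA &
      [/\ a = 2 * r * sin hA, b = 2 * r * sin hB, c = 2 * r * sin hC &
        d = 2 * r * sin hD]].
Proof.
move=> [[r0 ccw] [eA eC eB eD] [ab [s [ends nC nD]]]].
case: ccw => -[t1 [t2 [t3 [t4 [[h1 h2 h3 h4] [E1 E2 E3 E4]]]]]]; subst.
  have aE : alpha = t2 - t1.
    by apply: (arc_angle r0 h1 h2 _ ab ends nC); lra.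
  exists ((t2 - t1) / 2), ((t4 - t3) / 2), ((t3 - t2) / 2), ((t1 + 2 * pi - t4) / 2).
  split.
  - by split=> //; lra.
  - by field.
  - by rewrite aE; field.
  - by split; [| | |rewrite -(circD2pi O r t1)]; rewrite dist2_circ//; lra.
(* In the opposite orientation t1, ..., t4 carry D, C, B, A. The edge a runs from t3 to t4, and the
   excluded vertex is D, reached at t1 + 2 pi. *)
have ends' : (circ O r t3 = circ O r s /\ circ O r t4 = circ O r (s + alpha)) \/
    (circ O r t4 = circ O r s /\ circ O r t3 = circ O r (s + alpha)).
  by case: ends; [right|left].
have aE : alpha = t4 - t3.
  rewrite -(circD2pi O r t1) in nD.
  by apply: (arc_angle r0 h3 h4 _ ab ends' nD); lra.
exists ((t4 - t3) / 2), ((t2 - t1) / 2), ((t3 - t2) / 2), ((t1 + 2 * pi - t4) / 2).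
split.
- by split=> //; lra.
- by field.
- by rewrite aE; field.
- by split; rewrite dist2C; [| | |rewrite -(circD2pi O r t1)]; rewrite dist2_circ//; lra.
Qed.

End CircleGeometry.

(** * Construction of the cyclic quadrilateral *)

Section Existence.
Context {R : realType}.

(* The side b, the side a and the diagonal f form a triangle with exterior
   angle x = A + B between a and b, so that f = 2 r sin x. *)
Lemma triangle_half_angles (a b x f : R) : 0 < a -> 0 < b -> 0 < x < pi ->
  0 < f -> f ^+ 2 = a ^+ 2 + b ^+ 2 + 2 * a * b * cos x ->
  exists A, [/\ 0 < A, A < x, a = f / sin x * sin A & b = f / sin x * sin (x - A)].
Proof.
move=> a0 b0 /andP[x0 xpi] f0 fE.
have sx : 0 < sin x by apply: sin_gt0_pi; rewrite x0.
have cs : cos x ^+ 2 = 1 - sin x ^+ 2 by rewrite -(cos2Dsin2 x) addrK.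
have fn : f != 0 by rewrite gt_eqF.
have sn : sin x != 0 by rewrite gt_eqF.
(* The angle A is defined by f exp (i A) = b + a exp (i x), whose real part gives this cosine. *)
pose k := (b + a * cos x) / f.
have kE : k ^+ 2 + (a * sin x / f) ^+ 2 = 1.
  have -> : k ^+ 2 + (a * sin x / f) ^+ 2 =
      ((b + a * cos x) ^+ 2 + (a * sin x) ^+ 2) / f ^+ 2 by rewrite /k; field.
  have -> : (b + a * cos x) ^+ 2 + (a * sin x) ^+ 2 = f ^+ 2 by rewrite fE; ring: cs.
  by rewrite divff// expf_neq0.
have q0 : 0 < a * sin x / f by rewrite divr_gt0// mulr_gt0.
have kb : -1 <= k <= 1.
  have := sqr_ge0 (a * sin x / f) => h; apply/andP; split; nra.
have [/andP[A0 Api] cA] := acos_def kb.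
have sA : sin (acos k) = a * sin x / f.
  by rewrite sin_acos// -kE addrAC subrr add0r sqrtr_sqr gtr0_norm.
have sB : sin (x - acos k) = b * sin x / f.
  by rewrite sinB cA sA /k; field.
have sB0 : 0 < sin (x - acos k) by rewrite sB divr_gt0// mulr_gt0.
exists (acos k); split.
- rewrite lt_neqAle A0 andbT; apply: contraTneq q0 => e.
  by rewrite -sA -e sin0 ltxx.
- rewrite ltNge; apply/negP => h.
  move: h; rewrite le_eqVlt => /orP[/eqP e|h].
    by move: sB0; rewrite -e subrr sin0 ltxx.
  have : 0 < sin (acos k - x) by apply: sin_gt0_pi; lra.
  by rewrite -[acos k - x]opprB sinN oppr_gt0; move=> /(lt_trans sB0); rewrite ltxx.
- by rewrite sA; field; rewrite ?fn ?sn.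
- by rewrite sB; field; rewrite ?fn ?sn.
Qed.

(** Place a and b side by side: a diagonal then cuts the quadrilateral into triangles a, b, f and c,
    d, f. The order of the sides is immaterial for the inscribed angles. *)
Lemma cyclic_half_angles (a b c d : R) : 0 < a -> 0 < b -> 0 < c -> 0 < d ->
  a < b + c + d -> b < a + c + d -> c < a + b + d -> d < a + b + c ->
  exists h A B C D : R, [/\ [/\ 0 < h, 0 < A, 0 < B, 0 < C & 0 < D],
    A + B + C + D = pi &
    [/\ a = h * sin A, b = h * sin B, c = h * sin C & d = h * sin D]].
Proof.
move=> a0 b0 c0 d0 la lb lc ld.
pose m := 2 * (a * b + c * d).
have m0 : 0 < m by rewrite mulr_gt0// addr_gt0// mulr_gt0.
(* The cosine of A + B for which the two triangles assign the same length to the diagonal. The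
   bounds -1 < X < 1 are the four strict inequalities, paired as (c + d)^2 > (a - b)^2 and (a + b)^2
   > (c - d)^2. *)
pose X := (c ^+ 2 + d ^+ 2 - a ^+ 2 - b ^+ 2) / m.
have X1 : -1 < X < 1.
  have h1 : 0 < (a + b + c - d) * (a + b - c + d) by rewrite mulr_gt0//; lra.
  have h2 : 0 < (c + d + a - b) * (c + d - a + b) by rewrite mulr_gt0//; lra.
  rewrite /X ltr_pdivlMr// ltr_pdivrMr// /m; apply/andP; split; lra.
have X1' : -1 <= X <= 1 by lra.
have [/andP[x0 xpi] cx] := acos_def X1'.
set x := acos X in x0 xpi cx.
have xb : 0 < x < pi.
  rewrite !lt_neqAle x0 xpi !andbT; apply/andP; split; apply/eqP => e.
    by move: cx; rewrite -e cos0 => e1; move: X1; rewrite -e1 ltxx andbF.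
  by move: cx; rewrite e cospi => e1; move: X1; rewrite -e1 ltxx.
have F0 : 0 < a ^+ 2 + b ^+ 2 + 2 * a * b * cos x.
  rewrite cx.
  have ab : 0 < a * b by rewrite mulr_gt0.
  have := sqr_ge0 (a - b); have /andP[X2 _] := X1; nra.
pose f := Num.sqrt (a ^+ 2 + b ^+ 2 + 2 * a * b * cos x).
have f0 : 0 < f by rewrite sqrtr_gt0.
have fE : f ^+ 2 = a ^+ 2 + b ^+ 2 + 2 * a * b * cos x by rewrite sqr_sqrtr// ltW.
have cpi : cos (pi - x) = - cos x by rewrite addrC cosDpi cosN.
have spi : sin (pi - x) = sin x by rewrite addrC sinDpi sinN opprK.
have fE' : f ^+ 2 = c ^+ 2 + d ^+ 2 + 2 * c * d * cos (pi - x).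
  have mn : a * b + c * d != 0 by rewrite gt_eqF// addr_gt0// mulr_gt0.
  by rewrite fE cpi cx /X /m; field.
have xb' : 0 < pi - x < pi by lra.
have [A [A1 A2 Ea Eb]] := triangle_half_angles a0 b0 xb f0 fE.
have [C [C1 C2 Ec Ed]] := triangle_half_angles c0 d0 xb' f0 fE'.
rewrite spi in Ec Ed.
(* By the law of sines [f / sin x] is the common circumdiameter, the angles opposite to f being
   supplementary. *)
exists (f / sin x), A, (x - A), C, (pi - x - C); split=> //; last by ring.
split=> //; try lra.
by rewrite divr_gt0// sin_gt0_pi.
Qed.

Lemma quad_of_half_angles (h A B C D : R) : 0 < h ->
  0 < A -> 0 < B -> 0 < C -> 0 < D -> A + B + C + D = pi ->
  exists (O : R * R) (r : R) (P Q S T : R * R) (alpha : R),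
    quad_with_angle (h * sin A) (h * sin B) (h * sin C) (h * sin D) O r P Q S T alpha.
Proof.
move=> h0 A0 B0 C0 D0 sumE.
pose O : R * R := (0, 0); pose r := h / 2.
have r0 : 0 < r by rewrite divr_gt0.
have hE : h = 2 * r by rewrite /r; field.
(* The arcs follow the cyclic order a, c, b, d of the edges, so that of c precedes that of b. *)
pose t2 := 2 * A; pose t3 := t2 + 2 * C; pose t4 := t3 + 2 * B.
exists O, r, (circ O r 0), (circ O r t2), (circ O r t3), (circ O r t4), (2 * A).
have notin t : 2 * A < t -> t < 2 * pi -> ~ Defs.arc O r 0 (2 * A) (circ O r t).
  move=> t1 t2' [u]; rewrite /= in_itv/= => ub /(circ_eq r0)[e1 e2].
  have : cos (u - t) = 1 by rewrite cosB e1 e2 -!expr2 cos2Dsin2.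
  have bd : - (2 * pi) < u - t < 2 * pi by lra.
  by move=> /(cos_eq1 bd); lra.
split; last split.
- split=> //; left; exists 0, t2, t3, t4; split=> //.
  by split; rewrite /t4 /t3 /t2; lra.
- rewrite hE; split; [| | |rewrite -(circD2pi O r 0)]; rewrite dist2_circ//;
    rewrite /t4 /t3 /t2; first [by lra|congr (2 * r * sin _); lra].
- by rewrite mulr_gt0//=; lra.
- exists 0; split.
  + by left; rewrite add0r.
  + by apply: notin; rewrite /t3 /t2; lra.
  + by apply: notin; rewrite /t4 /t3 /t2; lra.
Qed.

End Existence.

Lemma asin0 (R : realType) : asin (0 : R) = 0.
Proof.
rewrite -[X in asin X](sin0 R) sinK// in_itv/=.
by have := pi_gt0 R; lra.
Qed.

(** Existence of Q is a separate clause, so that the formula for every such Q is not vacuous. When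
    one of b, c, d equals the sum of the other sides, Q collapses; there the arcsine has argument 0
    and its principal value is meant. *)
Theorem theorem8p3 (R : realType) (a b c d : R)
    (ha : 0 < a) (hb : 0 < b) (hc : 0 < c) (hd : 0 < d) :
  [/\ (b + c + d <= a -> edge_prob a b c d = 1),
      (a + c + d < b \/ a + b + d < c \/ a + b + c < d ->
        edge_prob a b c d = 0) &
      (a < b + c + d -> b <= a + c + d -> c <= a + b + d -> d <= a + b + c ->
        [/\ (b < a + c + d -> c < a + b + d -> d < a + b + c ->
              exists (O : R * R) (r : R) (A B C D : R * R) (alpha : R),
                quad_with_angle a b c d O r A B C D alpha),
            (forall (O : R * R) (r : R) (A B C D : R * R) (alpha : R),
              quad_with_angle a b c d O r A B C D alpha ->
              edge_prob a b c d = (alpha / (2 * pi))%:C /\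
              edge_prob a b c d =
                (pi^-1 * arcsin_branch alpha (arcsin_arg a b c d))%:C) &
            (b = a + c + d \/ c = a + b + d \/ d = a + b + c ->
              edge_prob a b c d = (pi^-1 * asin (arcsin_arg a b c d))%:C)])].
Proof.
split.
- exact: edge_prob_dominant.
- case=> [h|[h|h]].
  + by apply: edge_prob_opposite => //; exact: ltW.
  + by apply: edge_prob_adjacent => //; left; exact: ltW.
  + by apply: edge_prob_adjacent => //; right; exact: ltW.
move=> la _ _ _; split.
- move=> lb lc ld.
  have [h [A [B [C [D [[h0 A0 B0 C0 D0] sumE [-> -> -> ->]]]]]]] :=
    cyclic_half_angles ha hb hc hd la lb lc ld.
  exact: quad_of_half_angles.
- move=> O r A B C D alpha /quad_half_angles.
  move=> [A' [B' [C' [D' [[r0 A0 B0 C0 D0] sumE -> [-> -> -> ->]]]]]].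
  have r2 : 0 < 2 * r by rewrite mulr_gt0.
  rewrite edge_prob_half_angles// arcsin_arg_half_angles// arcsin_branch_sin//; last by lra.
  split; congr (_%:C); last by rewrite mulrC.
  have pn : (pi : R) != 0 by rewrite gt_eqF// pi_gt0.
  have h (p : R) : p != 0 -> A' / p = 2 * A' / (2 * p) by move=> ?; field.
  exact: h.
- move=> deg.
  have s0 : arcsin_arg a b c d = 0.
    rewrite /arcsin_arg.
    have -> : (a + b + c - d) * (a + b - c + d) * (a - b + c + d) * (- a + b + c + d) = 0.
      by case: deg => [->|[->|->]]; ring.
    by rewrite sqrtr0 mulr0 mul0r.
  rewrite s0 asin0 mulr0.
  case: deg => [h|[h|h]].
  + by apply: edge_prob_opposite => //; rewrite h.
  + by apply: edge_prob_adjacent => //; left; rewrite h.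
  + by apply: edge_prob_adjacent => //; right; rewrite h.
Qed.
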